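(* Let $c_1,\ldots, c_{n-1}$ be non-negative integers with $c_1 +\cdots+c_{n-1} = n-1$. Let $\Delta_{c_1,\ldots, c_{n-1}}$ be the set of left-right diagrams associated with $(c_1,\ldots, c_{n-1})$. Then the mixed Eulerian number $A_{c_1,\ldots,c_{n-1}}$ is equal to \begin{align*} A_{c_1,\ldots,c_{n-1}}=(n-1)! \sum_{P \in \Delta_{c_1,\ldots,c_{n-1}}} \mathrm{wt}(P). \end{align*}
   Context: Mixed Eulerian numbers: for real numbers $a_1\geq a_2\geq\cdots\geq a_n$, the permutohedron $P_n(a_1,\ldots,a_n)$ is the convex hull of the points $(a_{w(1)},\ldots,a_{w(n)})\in\mathbb R^n$, $w\in S_n$; its volume is the usual $(n-1)$-dimensional volume of its image under the projection $(t_1,\ldots,t_n)\mapsto(t_1,\ldots,t_{n-1})$. Setting $u_i=a_i-a_{i+1}$ ($1\le i\le n-1$), one has $\mathrm{Vol}\,P_n=\sum_{c_1,\ldots,c_{n-1}} A_{c_1,\ldots,c_{n-1}}\frac{u_1^{c_1}}{c_1!}\cdots\frac{u_{n-1}^{c_{n-1}}}{c_{n-1}!}$, the sum over non-negative integers with $c_1+\cdots+c_{n-1}=n-1$; the coefficients $A_{c_1,\ldots,c_{n-1}}$ are the mixed Eulerian numbers. Left-right diagrams: let $M$ be the multiset in which each $j\in[n-1]$ appears $c_j$ times, let $J=\{j\in[n-1]\mid c_j\ge 1\}$ (an ordinary set) and $I=M\setminus J$ (possibly a multiset). Draw a grid of $(1+|I|)\times(n-1)$ boxes, the columns labeled $1,\ldots,n-1$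 from left to right (column numbers); label the rows from the second to the bottom row by the elements of $I$ in weakly increasing order (row numbers). Shade the boxes of the first row whose column numbers lie in $J$, and in each row from the second on, mark the box whose column number equals the row number. Then, successively for $k=1,\ldots,|I|$: shade in row $k+1$ the boxes in the same columns as the shaded boxes of row $k$; then, for the maximal consecutive string of shaded boxes in row $k+1$ containing the marked box, shade additionally one of the non-shaded boxes (inside the grid) immediately to its left or immediately to its right (the additional shaded box). A left-right diagram associated with $(c_1,\ldots,c_{n-1})$ is a configuration of shaded boxes obtained by some sequence of such choices; $\Delta_{c_1,\ldots,c_{n-1}}$ denotes the set of them. Weight: for each row except the first, let $\{a,a+1,\ldots,b\}$ be the column numbers of the maximal consecutive string of shaded boxes (copied from the previous row, i.e., before adding the additional shaded box) containing the marked box, and let $i$ ($a\le i\le b$) be the column number of the marked box. Assign to the row the number $\frac{b-i+1}{b-a+2}$ if the additional shaded box is to the left, and $\frac{i-a+1}{b-a+2}$ if it is to the right. The weight $\mathrm{wt}(P)$ of a left-right diagram $P$ is the product of these numbers over all rows except the first. *)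

(* Defs.v *)
From HB Require Import structures.
From mathcomp Require Import all_boot all_order all_algebra all_fingroup.
From mathcomp Require Import all_classical all_reals all_analysis.
Set Implicit Arguments.
Unset Strict Implicit.
Unset Printing Implicit Defensive.
Import Order.TTheory GRing.Theory Num.Theory.
Local Open Scope classical_set_scope.
Local Open Scope ring_scope.

(* Index conventions: n is the dimension of the permutohedron, so that n.+1
   real numbers a_0 >= ... >= a_n are permuted; all indices start at 0. *)

(* The n-fold product of the one-dimensional Lebesgue measure, by slicing along
   the first coordinate as in [product_measure1]; a point in dimension 0 has
   volume 1. *)
Fixpoint volume (R : realType) (n : nat) : set 'rV[R]_n -> \bar R :=
  match n with
  | 0%N => fun A => (\1_A (0 : 'rV[R]_0))%:E
  | m.+1 => fun A =>
      (\int[lebesgue_measure]_x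
         volume [set v : 'rV[R]_m | A (row_mx (x%:M : 'rV[R]_1) v)])%E
  end.

Definition convex_hull (R : realType) (E : lmodType R) (X : set E) : set E :=
  smallest (fun A : set E => convex_set (A : set (convex_lmodType E))) X.

Definition permutohedron (R : realType) (n : nat) (a : 'I_n.+1 -> R) :
    set 'rV[R]_n.+1 :=
  convex_hull
    (range (fun w : {perm 'I_n.+1} => \row_(i < n.+1) a (w i))).

Definition drop_last (R : realType) (n : nat) (t : 'rV[R]_n.+1) : 'rV[R]_n :=
  \row_(i < n) t 0 (widen_ord (leqnSn n) i).

Definition permutohedron_volume (R : realType) (n : nat) (a : 'I_n.+1 -> R) :
    \bar R :=
  volume (@drop_last R n @` permutohedron a).

(* A c is the coefficient of \prod_i u_i ^ c_i / c_i! in the volume, where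
   u_i = a_i - a_(i+1).  Exponents summing to n are at most n, so it is enough
   to sum over functions with values in 'I_n.+1. *)
Definition is_mixed_eulerian (R : realType) (n : nat)
    (A : {ffun 'I_n -> nat} -> R) : Prop :=
  forall a : 'I_n.+1 -> R,
    (forall i j : 'I_n.+1, (i <= j)%N -> a j <= a i) ->
    permutohedron_volume a =
    (\sum_(c : {ffun 'I_n -> 'I_n.+1} | (\sum_(i < n) c i == n)%N)
       A [ffun i => c i : nat] *
       \prod_(i < n)
         ((a (widen_ord (leqnSn n) i) - a (lift ord0 i)) ^+ c i / (c i)`!%:R)
    )%:E.

(* The family is determined by [is_mixed_eulerian] only at the c with
   \sum_i c i = n; it is meaningless elsewhere. *)
Definition mixed_eulerian (R : realType) (n : nat) (c : {ffun 'I_n -> nat}) : R :=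
  xget (fun=> 0) [set A | @is_mixed_eulerian R n A] c.

Local Close Scope classical_set_scope.

(* The multiset M \ J, listed in weakly increasing order: its k-th element is
   the row number of row k + 1, row 0 being the unlabelled one. *)
Definition row_numbers (n : nat) (c : {ffun 'I_n -> nat}) : seq 'I_n :=
  flatten [seq nseq (c j).-1 j | j <- enum 'I_n].

Section LeftRightDiagrams.
Local Open Scope nat_scope.
Variable n : nat.
Implicit Types (S T : {set 'I_n}) (i j : 'I_n).

Definition shaded_string S i : {set 'I_n} :=
  [set j : 'I_n | [forall k : 'I_n, (minn i j <= k <= maxn i j) ==> (k \in S)]].

(* When i is in S, the string is {a, ..., b} with a = string_min S i and
   b = string_max S i. *)
Definition string_min S i : 'I_n := [arg min_(j < i in shaded_string S i) (j : nat)].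
Definition string_max S i : 'I_n := [arg max_(j > i in shaded_string S i) (j : nat)].

(* T is the row obtained from the copied row S with marked box i by shading the
   box to the left (resp. right) of the string. *)
Definition adds_left S i T : bool :=
  [exists j : 'I_n, (j.+1 == string_min S i) && (T == j |: S)].
Definition adds_right S i T : bool :=
  [exists j : 'I_n, (j == (string_max S i).+1 :> nat) && (T == j |: S)].

Variable c : {ffun 'I_n -> nat}.

Definition num_extra : nat := size (row_numbers c).

Definition row_number (k : 'I_num_extra) : 'I_n := tnth (in_tuple (row_numbers c)) k.

(* A configuration of shaded boxes: the set of shaded columns of each row. *)
Definition configuration : Type := {ffun 'I_num_extra.+1 -> {set 'I_n}}.

Definition row_above (P : configuration) (k : 'I_num_extra) : {set 'I_n} :=
  P (widen_ord (leqnSn _) k).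
Definition labelled_row (P : configuration) (k : 'I_num_extra) : {set 'I_n} :=
  P (lift ord0 k).

Definition left_right_diagrams : {set {ffun 'I_num_extra.+1 -> {set 'I_n}}} :=
  [set P : {ffun 'I_num_extra.+1 -> {set 'I_n}} |
     (P ord0 == [set j : 'I_n | 1 <= c j]) &&
     [forall k : 'I_num_extra,
        adds_left (row_above P k) (row_number k) (labelled_row P k)
        || adds_right (row_above P k) (row_number k) (labelled_row P k)]].

End LeftRightDiagrams.

Definition row_weight (R : realType) (n : nat) (S : {set 'I_n}) (i : 'I_n)
    (T : {set 'I_n}) : R :=
  let a := string_min S i in
  let b := string_max S i in
  if adds_left S i T then (b - i + 1)%N%:R / (b - a + 2)%N%:R
  else (i - a + 1)%N%:R / (b - a + 2)%N%:R.

Definition weight (R : realType) (n : nat) (c : {ffun 'I_n -> nat})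
    (P : configuration c) : R :=
  \prod_(k < num_extra c)
    row_weight R (row_above P k) (row_number k) (labelled_row P k).

(* Main.v *)
(** By Rado's theorem the permutohedron is cut out by the conditions that the
    coordinates have sum a_1 + ... + a_(n+1) and that any m of them add up to at
    most a_1 + ... + a_m. Hence its slice at first coordinate x, with
    a_(k+1) <= x <= a_k, is the permutohedron of
    a_1, ..., a_(k-1), a_k + a_(k+1) - x, a_(k+2), ...
    Integrating over x and expanding in divided powers of the u_i, the volume
    polynomial has coefficients given by the recursion
      A(c) = sum over k and over i + j = c_k - 1 of
             A(..., c_(k-1) + i, c_(k+1) + j, ...).
    The recursion implies A(1, ..., 1) = n! and the Laplace relations
      2 A(c + 2 e_i) = A(c + e_i + e_(i-1)) + A(c + e_i + e_(i+1)).
    So, when the marked box i moves along a string of shaded boxes, the value of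
    A is an affine function of i; interpolating between the two ends of the string
    gives the two weights of a left-right diagram, and adding boxes one row after
    the other leads from c to (1, ..., 1). *)
From mathcomp Require Import all_boot all_order all_algebra all_fingroup.
From mathcomp Require Import zify ring lra.
From mathcomp Require Import all_classical all_reals all_analysis.
From mathcomp Require Import measurable_realfun.
Require Import Defs.
Set Implicit Arguments.
Unset Strict Implicit.
Unset Printing Implicit Defensive.
Import Order.TTheory GRing.Theory Num.Theory.
Import numFieldNormedType.Exports.

(** * The coefficient recursion *)

Local Open Scope nat_scope.

Ltac split_at m :=
  repeat (match goal with
          | |- context [m < ?k] => case: (ltnP m k) => ? /=
          | |- context [m == ?k] => case: (eqVneq m k) => ? /=
          end; try by [|lia]); subst; rewrite /= ?eqxx /=; try lia.

Definition incr (i : nat) (c : nat -> nat) : nat -> nat :=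
  fun m => c m + (m == i).

(** One term of the recursion: position [k.+1] disappears, one of its units is used up by the
    integration, [j] units go to the left neighbour and the others to the right one. *)
Definition contract (k j : nat) (c : nat -> nat) : nat -> nat := fun i =>
  if i < k then c i
  else if i == k then c k + j
  else if i == k.+1 then c k.+2 + (c k.+1 - j.+1)
  else c i.+1.

(** An extreme contraction of [incr k.+1 c]: with all free units sent right it is [merge k.+1 c],
    with all sent left it is [merge k c]. *)
Definition merge (k : nat) (c : nat -> nat) : nat -> nat := fun i =>
  if i < k then c i else if i == k then c k + c k.+1 else c i.+1.

(* The exponent of the [i]-th variable, [1 <= i <= n], is [c i]; positions [0] and
   [n.+1] are virtual, and the coefficient vanishes unless both carry [0]. *)
Fixpoint eulerian_coef (n : nat) (c : nat -> nat) : nat :=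
  if n is m.+1 then
    \sum_(k < m.+1) \sum_(j < c k.+1) eulerian_coef m (contract k j c)
  else (c 0 == 0) && (c 1 == 0).

(** The share of the slices whose first coordinate lies between the parameters numbered [k] and
    [k.+1], counting from 0. *)
Definition eulerian_part (n k : nat) (c : nat -> nat) : nat :=
  \sum_(j < c k.+1) eulerian_coef n (contract k j c).

Lemma eulerian_coefS n c :
  eulerian_coef n.+1 c = \sum_(k < n.+1) eulerian_part n k c.
Proof. by []. Qed.

Lemma contract_incr_le k j i c : i <= k ->
  contract k j (incr i c) = incr i (contract k j c).
Proof.
move=> ik; apply/funext => m; rewrite /contract /incr.
case: ltngtP => [//|km|->]; last by lia.
by have -> : (k.+2 == i) = false; [lia|]; have -> : (k.+1 == i) = false; [lia|];
   case: eqP => [->|_]; lia.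
Qed.

Lemma contract_incr_ge k j i c : k < i ->
  contract k j (incr i.+1 c) = incr i (contract k j c).
Proof.
move=> ik; apply/funext => m; rewrite /contract /incr.
case: ltngtP => [|km|->]; try by lia.
by have -> : (k.+1 == i.+1) = false; [lia|]; case: eqP => [->|_]; lia.
Qed.

Lemma part_incr_le n k i c : i <= k ->
  eulerian_part n k (incr i c) =
  \sum_(j < c k.+1) eulerian_coef n (incr i (contract k j c)).
Proof.
move=> ik; rewrite /eulerian_part.
have -> : incr i c k.+1 = c k.+1 by rewrite /incr; lia.
by apply: eq_bigr => j _; rewrite contract_incr_le.
Qed.

Lemma part_incr_ge n k i c : k < i ->
  eulerian_part n k (incr i.+1 c) =
  \sum_(j < c k.+1) eulerian_coef n (incr i (contract k j c)).
Proof.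
move=> ik; rewrite /eulerian_part.
have -> : incr i.+1 c k.+1 = c k.+1 by rewrite /incr; lia.
by apply: eq_bigr => j _; rewrite contract_incr_ge.
Qed.

(** On the left, the summand [j = 0] gives the [merge] term; in every other summand one of the units
    moving left can be counted beforehand at position [k]. *)
Lemma part_incr_left n k c :
  eulerian_part n k (incr k.+1 c) =
  eulerian_part n k (incr k c) + eulerian_coef n (merge k.+1 c).
Proof.
rewrite /eulerian_part.
have -> : incr k.+1 c k.+1 = (c k.+1).+1 by rewrite /incr eqxx addn1.
have -> : incr k c k.+1 = c k.+1 by rewrite /incr; lia.
rewrite big_ord_recl addnC; congr (_ + _).
  apply: eq_bigr => j _; congr eulerian_coef; apply/funext => m.
  rewrite /contract /incr /= /bump /=; have := ltn_ord j.
  by split_at m.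
congr eulerian_coef; apply/funext => m; rewrite /contract /incr /merge /=.
by split_at m.
Qed.

(** Mirror image of [part_incr_left]: the last summand, with all free units moving left, is split
    off. *)
Lemma part_incr_right n k c :
  eulerian_part n k (incr k.+1 c) =
  eulerian_part n k (incr k.+2 c) + eulerian_coef n (merge k c).
Proof.
rewrite /eulerian_part.
have -> : incr k.+1 c k.+1 = (c k.+1).+1 by rewrite /incr eqxx addn1.
have -> : incr k.+2 c k.+1 = c k.+1 by rewrite /incr; lia.
rewrite big_ord_recr /=; congr (_ + _).
  apply: eq_bigr => j _; congr eulerian_coef; apply/funext => m.
  rewrite /contract /incr /= /bump /=; have := ltn_ord j.
  by split_at m.
congr eulerian_coef; apply/funext => m; rewrite /contract /incr /merge /=.
by split_at m.
Qed.

(** Each contraction lowers the total by exactly one, and the base case is nonzero only for total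
    0. *)
Lemma eulerian_coef_sum n (c : nat -> nat) :
  \sum_(i < n.+2) c i != n -> eulerian_coef n c = 0.
Proof.
elim: n c => [|n IH] c /=.
  by rewrite !big_ord_recr big_ord0 /=; case: (c 0); case: (c 1).
move=> sc; rewrite big1 // => k _; rewrite big1 // => j _; apply: IH.
apply: contraNN sc => /eqP sc; apply/eqP.
have hj := ltn_ord j; have hk := ltn_ord k.
have hr : n.+3 = k + 3 + (n - k) by lia.
have hr' : n.+2 = k + 2 + (n - k) by lia.
rewrite -(big_mkord xpredT) in sc; rewrite -(big_mkord xpredT).
rewrite hr' (@big_cat_nat _ _ _ (k + 2)) //= in sc; last by lia.
rewrite (@big_cat_nat _ _ _ k) //= in sc; last by lia.
rewrite (@big_cat_nat _ _ _ (k + 3)) //=; last by lia.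
rewrite hr (@big_cat_nat _ _ _ k) //=; last by lia.
move: sc.
rewrite [\sum_(k <= i < k + 2) _]big_ltn ?[\sum_(k.+1 <= i < k + 2) _]big_ltn;
  try by lia.
rewrite [\sum_(k.+2 <= i < k + 2) _]big_geq; last by lia.
rewrite [\sum_(k <= i < k + 3) _]big_ltn ?[\sum_(k.+1 <= i < k + 3) _]big_ltn
  ?[\sum_(k.+2 <= i < k + 3) _]big_ltn; try by lia.
rewrite [\sum_(k.+3 <= i < k + 3) _]big_geq; last by lia.
have -> : \sum_(0 <= i < k) contract k j c i = \sum_(0 <= i < k) c i.
  by apply: eq_big_nat => i /andP[_ ik]; rewrite /contract ik.
have -> : \sum_(k + 2 <= i < k + 2 + (n - k)) contract k j c i =
          \sum_(k + 3 <= i < k + 3 + (n - k)) c i.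
  have -> : k + 3 = (k + 2).+1 by rewrite !addnS.
  rewrite addSn.
  rewrite big_add1 /=; apply: eq_big_nat => i /andP[h1 h2].
  by rewrite /contract; do 3 (case: ifP; [lia|] => _).
rewrite /contract ltnn eqxx ltnNge leqnSn /= eqn_leq ltnn eqxx.
move=> /=; lia.
Qed.

Lemma eulerian_coef_left n c : 0 < c 0 -> eulerian_coef n c = 0.
Proof.
elim: n c => [|n IH] c c0 /=; first by case: eqP c0; lia.
rewrite big1 // => k _; rewrite big1 // => j _; apply: IH.
by rewrite /contract; case: ifP => //; case: eqP => [e|]; [rewrite -[X in c X]e|]; lia.
Qed.

Lemma eulerian_coef_right n c : 0 < c n.+1 -> eulerian_coef n c = 0.
Proof.
elim: n c => [|n IH] c c0 /=; first by case: eqP; case: eqP c0; lia.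
rewrite big1 // => k _; rewrite big1 // => j _; apply: IH.
have := ltn_ord k; rewrite /contract; do 2 (case: ifP; first by lia).
by case: ifP => // /eqP [e] _ _ _; move: c0; rewrite (_ : n.+2 = k.+2); lia.
Qed.

(* The Laplace operator sends the [k]-th part of the recursion to the inductive
   case plus values of [merge], which cancel between [k = i] and
   [k = i - 1, i + 1]; at both ends the missing neighbour is compensated by the
   vanishing of the coefficients at the boundary positions. *)
Lemma eulerian_coef_laplace n i c : i < n ->
  2 * eulerian_coef n (incr i.+1 (incr i.+1 c)) =
  eulerian_coef n (incr i (incr i.+1 c)) +
  eulerian_coef n (incr i.+2 (incr i.+1 c)).
Proof.
elim: n i c => // n IH i c ilt; rewrite !eulerian_coefS.
set c' := incr i.+1 c.
pose M k := eulerian_coef n (merge k c').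
(* The [merge] terms are placed so that nothing is subtracted in [nat]. For [k = i] both stand on
   the right; their counterparts on the left come from [k = i + 1] and [k = i - 1]. *)
have key k : k < n.+1 ->
  2 * eulerian_part n k (incr i.+1 c') +
    ((k == i.+1) * M i.+1 + (k.+1 == i) * M i) =
  eulerian_part n k (incr i c') + eulerian_part n k (incr i.+2 c') +
    (k == i) * (M i.+1 + M i).
  move=> kn.
  have [lt_ik|lt_ki|eq_ik] := ltngtP i k; last first.
  - rewrite eq_ik; have := part_incr_left n k c'; have := part_incr_right n k c'.
    by rewrite /M; lia.
  - case: i lt_ki ilt @c' @M => // i ki ilt c' M.
    have -> : (k == i.+2) = false by lia.
    rewrite mul0n add0n addn0 eqSS.
    pose S m := \sum_(j < c k.+1)
      eulerian_coef n (incr m (incr i.+1 (contract k j c))).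
    have ES m : \sum_(j < c' k.+1) eulerian_coef n (incr m (contract k j c')) = S m.
      rewrite /S (_ : c' k.+1 = c k.+1); last by rewrite /c' /incr; lia.
      by apply: eq_bigr => j _; rewrite /c' contract_incr_ge //; lia.
    have IH' : 2 * S i.+1 = S i + S i.+2.
      by rewrite /S big_distrr -big_split; apply: eq_bigr => j _; apply: IH; lia.
    rewrite [eulerian_part n k (incr i.+2 c')]part_incr_ge; last by lia.
    rewrite [eulerian_part n k (incr i.+3 c')]part_incr_ge; last by lia.
    rewrite !ES IH'.
    have [ki'|ki'] := eqVneq k i.
      have := part_incr_left n k c'; rewrite [in RHS]part_incr_le // ES /M ki'.
      by lia.
    by rewrite part_incr_ge ?ES; lia.
  - have -> : (k.+1 == i) = false by lia.
    rewrite mul0n !addn0.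
    pose S m := \sum_(j < c k.+1)
      eulerian_coef n (incr m (incr i.+1 (contract k j c))).
    have ES m : \sum_(j < c' k.+1) eulerian_coef n (incr m (contract k j c')) = S m.
      rewrite /S (_ : c' k.+1 = c k.+1); last by rewrite /c' /incr; lia.
      by apply: eq_bigr => j _; rewrite /c' contract_incr_le //; lia.
    have IH' : 2 * S i.+1 = S i + S i.+2.
      by rewrite /S big_distrr -big_split; apply: eq_bigr => j _; apply: IH; lia.
    rewrite [eulerian_part n k (incr i.+1 c')]part_incr_le; last by lia.
    rewrite [eulerian_part n k (incr i c')]part_incr_le; last by lia.
    rewrite !ES IH'.
    have [ki'|ki'] := eqVneq k i.+1.
      have := part_incr_right n k c'; 
      rewrite [in RHS]part_incr_ge //.
      by rewrite !ES /M ki'; lia.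
    by rewrite part_incr_le ?ES; lia.
have : \sum_(k < n.+1) (2 * eulerian_part n k (incr i.+1 c') +
    ((k == i.+1 :> nat) * M i.+1 + (k.+1 == i) * M i)) =
  \sum_(k < n.+1) (eulerian_part n k (incr i c') + eulerian_part n k (incr i.+2 c') +
    (k == i :> nat) * (M i.+1 + M i)).
  by apply: eq_bigr => k _; apply: key.
rewrite !big_split /= big1_eq addn0.
have -> : \sum_(k < n.+1) (k == i.+1 :> nat) * M i.+1 =
  (\sum_(k < n.+1) (k == i.+1 :> nat)) * M i.+1 by rewrite big_distrl.
have -> : \sum_(k < n.+1) (k.+1 == i) * M i =
  (\sum_(k < n.+1) (k.+1 == i)) * M i by rewrite big_distrl.
have -> : \sum_(k < n.+1) (k == i :> nat) * (M i.+1 + M i) =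
  (\sum_(k < n.+1) (k == i :> nat)) * (M i.+1 + M i) by rewrite big_distrl.
have count_eq m : \sum_(k < n.+1) (k == m :> nat) = (m < n.+1).
  have [mn|mn] := ltnP m n.+1; last first.
    by rewrite big1 // => k _; have := ltn_ord k; lia.
  rewrite (bigD1 (Ordinal mn)) //= eqxx big1 ?addn0 // => k kn.
  by rewrite (_ : (k == m :> nat) = false) //; apply/negbTE.
have count_eqS : \sum_(k < n.+1) (k.+1 == i) = (0 < i).
  case: i ilt {c' M key} => [|i] ilt; first by rewrite big1.
  by under eq_bigr do rewrite eqSS; rewrite count_eq; lia.
rewrite !count_eq count_eqS ilt.
have M0 : i = 0 -> M 0 = 0.
  by move=> i0; rewrite /M eulerian_coef_left // /merge /c' i0 /incr /=; lia.
have Mn : i = n -> M n.+1 = 0.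
  move=> i0; rewrite /M eulerian_coef_right // /merge /c' i0 /incr ltnn eqxx.
  by lia.
case: (ltngtP i n) => in_; try by lia.
  case: (posnP i) => i0; last by lia.
  by move: M0; rewrite i0 => /(_ erefl); lia.
case: (posnP i) => i0; move: M0 Mn; rewrite in_; last by lia.
by rewrite -in_ i0 => /(_ erefl) ? /(_ erefl) ?; lia.
Qed.

(** Each of the [n.+1] parts has the single summand [j = 0], and contracting an all-ones exponent
    gives the shorter all-ones exponent. *)
Lemma eulerian_coef1 n :
  eulerian_coef n (fun i => (0 < i) && (i < n.+1)) = n`!.
Proof.
elim: n => // n IH; rewrite eulerian_coefS.
under eq_bigr => k _.
  rewrite /eulerian_part (_ : _ && _ = true); last by have := ltn_ord k; lia.
  rewrite big_ord_recl big_ord0 addn0.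
  rewrite (_ : contract _ _ _ = (fun i => (0 < i) && (i < n.+1))) ?IH.
    over.
  apply/funext => i; rewrite /contract; have := ltn_ord k => hk /=.
  by repeat (case: ifP => ?); lia.
by rewrite sum_nat_const card_ord factS.
Qed.

(** * Left-right diagrams *)

Section Diagrams.
Variable n : nat.
Implicit Types (S T : {set 'I_n}) (i : 'I_n) (r : seq 'I_n).

Lemma string_minP S i : i \in S ->
  [/\ string_min S i <= i,
      forall k : 'I_n, string_min S i <= k <= i -> k \in S &
      forall k : 'I_n, k.+1 = string_min S i -> k \notin S].
Proof.
move=> iS; rewrite /string_min.
have ii : i \in shaded_string S i.
  rewrite inE; apply/forallP => k; apply/implyP; rewrite minnn maxnn => ki.
  by rewrite (_ : k = i) //; apply/val_inj/eqP; rewrite eqn_leq andbC.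
case: arg_minnP => // a; rewrite inE => /forallP aS amin.
have ai : a <= i by exact: amin.
have aSi (k : 'I_n) : a <= k <= i -> k \in S.
  by move: (aS k) => /implyP h kai; apply: h; lia.
split=> // k ka; apply/negP => kS.
suff /amin : k \in shaded_string S i by lia.
rewrite inE; apply/forallP => m; apply/implyP => mk.
have [->//|mk'] := eqVneq m k.
by apply: aSi; move/eqP: mk' => mk'; have := contra_not (@val_inj _ _ _ m k) mk';
   rewrite /=; lia.
Qed.

Lemma string_maxP S i : i \in S ->
  [/\ i <= string_max S i,
      forall k : 'I_n, i <= k <= string_max S i -> k \in S &
      forall k : 'I_n, k = (string_max S i).+1 :> nat -> k \notin S].
Proof.
move=> iS; rewrite /string_max.
have ii : i \in shaded_string S i.
  rewrite inE; apply/forallP => k; apply/implyP; rewrite minnn maxnn => ki.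
  by rewrite (_ : k = i) //; apply/val_inj/eqP; rewrite eqn_leq andbC.
case: arg_maxnP => // b; rewrite inE => /forallP bS bmax.
have ib : i <= b by exact: bmax.
have bSi (k : 'I_n) : i <= k <= b -> k \in S.
  by move: (bS k) => /implyP h kai; apply: h; lia.
split=> // k kb; apply/negP => kS.
suff /bmax : k \in shaded_string S i by rewrite /=; lia.
rewrite inE; apply/forallP => m; apply/implyP => mk.
have [->//|mk'] := eqVneq m k.
by apply: bSi; move/eqP: mk' => mk'; have := contra_not (@val_inj _ _ _ m k) mk';
   rewrite /=; lia.
Qed.

Lemma string_subset S i : i \in S -> forall k : 'I_n,
  string_min S i <= k <= string_max S i -> k \in S.
Proof.
move=> iS k kab; have [_ l _] := string_minP iS; have [_ h _] := string_maxP iS.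
by case: (leqP k i) => ki; [apply: l|apply: h]; lia.
Qed.

(* Column [j] of the grid is position [j.+1] of an exponent function. *)
Definition exponents S r : nat -> nat := fun m =>
  \sum_(j in S) (m == j.+1) + \sum_(j <- r) (m == j.+1).

Lemma exponents_cons S i r : exponents S (i :: r) = incr i.+1 (exponents S r).
Proof.
by apply/funext => m; rewrite /exponents /incr big_cons; lia.
Qed.

Lemma exponentsU1 S i r : i \notin S ->
  exponents (i |: S) r = incr i.+1 (exponents S r).
Proof.
by move=> iS; apply/funext => m; rewrite /exponents /incr big_setU1 //=; lia.
Qed.

Lemma exponents_gt0 S i r : i \in S -> 0 < exponents S r i.+1.
Proof. by move=> iS; rewrite /exponents (bigD1 i) //= eqxx. Qed.

(** A unit already present at position [i.+1] serves as one of the two increments in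
    [eulerian_coef_laplace]. *)
Lemma eulerian_coef_incr i (c : nat -> nat) : 0 < c i.+1 ->
  2 * eulerian_coef n (incr i.+1 c) =
  eulerian_coef n (incr i c) + eulerian_coef n (incr i.+2 c).
Proof.
move=> ci; have -> : c = incr i.+1 (fun m => c m - (m == i.+1)).
  apply/funext => m; rewrite /incr; case: eqVneq => [->|_] /=; last by lia.
  by rewrite subnK.
exact: eulerian_coef_laplace.
Qed.

Section Field.
Variable R : realType.
Local Open Scope ring_scope.

(** The second differences vanish, so [x] is affine on [0, ..., d] and is interpolated from its end
    values. *)
Lemma discrete_harmonic (x : nat -> R) (d j : nat) : (j <= d)%N ->
  (forall k, (k.+1 < d)%N -> 2 * x k.+1 = x k + x k.+2) ->
  d%:R * x j = (d - j)%N%:R * x 0 + j%:R * x d.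
Proof.
move=> jd h.
have lin k : (k <= d)%N -> x k = x 0 + k%:R * (x 1 - x 0).
  elim/ltn_ind: k => -[|[|k]] IH kd; [by ring|by ring|].
  have := h k kd; rewrite (IH k) ?(IH k.+1) //; try by lia.
  rewrite -[k.+2%:R]natr1 -[k.+1%:R]natr1 => e.
  have -> : x k.+2 = 2 * (x 0 + (k%:R + 1) * (x 1 - x 0)) - (x 0 + k%:R * (x 1 - x 0)).
    by rewrite e; ring.
  by ring.
by rewrite (lin _ jd) (lin _ (leqnn d)) natrB //; ring.
Qed.

(** Expansion along one row: the Laplace relation holds at every box of the string, so the
    coefficient is affine in the position of the marked unit, and the two boxes adjacent to the
    string are the ends of the interpolation. *)
Lemma eulerian_coef_diagram_step S i r : i \in S ->
  (eulerian_coef n (exponents S (i :: r)))%:R =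
  \sum_(T | adds_left S i T || adds_right S i T)
    row_weight R S i T * (eulerian_coef n (exponents T r))%:R.
Proof.
move=> iS; set a := string_min S i; set b := string_max S i.
have [ai _ aS] := string_minP iS; have [ib _ bS] := string_maxP iS.
rewrite -/a in ai aS; rewrite -/b in ib bS.
(* Column [j] is position [j.+1]: thus [m = 0] is just left of the string, [m = b - a + 2] just
   right of it, and [m = i - a + 1] is the marked box. *)
pose x m : R := (eulerian_coef n (incr (a + m) (exponents S r)))%:R.
have dE : (b - a + 2)%N%:R != 0 :> R by rewrite pnatr_eq0; lia.
have hx : (b - a + 2)%N%:R * x (i - a + 1)%N =
    (b - i + 1)%N%:R * x 0%N + (i - a + 1)%N%:R * x (b - a + 2)%N.
  rewrite (@discrete_harmonic x (b - a + 2)); [|lia|].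
    by congr (_%:R * _ + _); lia.
  move=> k kd; have kn : (a + k < n)%N by have := ltn_ord b; lia.
  have kS : Ordinal kn \in S by apply: (string_subset iS); rewrite -/a -/b /=; lia.
  by rewrite /x !addnS -natrM -natrD -(eulerian_coef_incr (exponents_gt0 r kS)).
have -> : (eulerian_coef n (exponents S (i :: r)))%:R =
    (b - i + 1)%N%:R / (b - a + 2)%N%:R * x 0%N +
    (i - a + 1)%N%:R / (b - a + 2)%N%:R * x (b - a + 2)%N.
  rewrite exponents_cons (_ : i.+1 = a + (i - a + 1))%N; last by lia.
  by rewrite -/(x _); apply: (mulfI dE); rewrite hx; field.
rewrite (bigID (adds_left S i)) /=; congr (_ + _).
  rewrite (eq_bigl (adds_left S i)); last first.
    by move=> T /=; case: adds_left; rewrite ?andbF.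
  (* If the string touches the left border, no box can be added there, and the end value vanishes
     because its unit sits at the virtual position 0. *)
  case a0 : (a : nat) => [|a'] in aS *.
    rewrite big_pred0 => [|T].
      by rewrite /x addn0 a0 eulerian_coef_left ?mulr0 // /incr eqxx addn1.
    by apply/negbTE/existsPn => j; rewrite -/a a0.
  have a'n : (a' < n)%N by have := ltn_ord a; move: a0 => /=; lia.
  pose j := Ordinal a'n; have jS : j \notin S by apply: aS.
  have jE T : adds_left S i T = (T == j |: S).
    apply/existsP/eqP => [[k /andP[/eqP ka /eqP ->]]|->]; last first.
      by exists j; rewrite eqxx andbT -/a a0.
    by congr (_ |: _); apply: val_inj => /=; move: ka; rewrite -/a a0 => -[].
  rewrite (big_pred1 (j |: S)) => [|T]; last exact: jE.
  rewrite /row_weight jE eqxx -/a -/b exponentsU1 // /x addn0 /=.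
  by move: a0 => /= ->.
(* No [T] arises from both sides, so the order of the tests in [row_weight] does no harm. *)
have rE T : (adds_left S i T || adds_right S i T) && ~~ adds_left S i T =
            adds_right S i T.
  case: (boolP (adds_left S i T)) => /= [|_]; last by rewrite andbT.
  move=> /existsP[j /andP[/eqP ja /eqP ->]].
  apply/esym/negbTE/existsPn => k; apply/negP => /andP[/eqP kb /eqP].
  move/setP => /(_ j); rewrite !inE eqxx /= => /esym /orP[/eqP jk|jS].
    by move: ja kb; rewrite jk -/a -/b; lia.
  by have := aS _ ja; rewrite jS.
rewrite (eq_bigl _ _ rE).
have nl T : adds_right S i T -> adds_left S i T = false.
  by move=> rT; have := rE T; rewrite rT orbT /= => /negbTE.
have [bn|bn] := ltnP b.+1 n; last first.
  rewrite big_pred0 => [|T].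
    rewrite /x eulerian_coef_right ?mulr0 //.
    by rewrite /incr; have := ltn_ord b; case: eqP; lia.
  apply/negbTE/existsPn => j; rewrite -/b; have := ltn_ord j.
  by case: eqP => //=; lia.
pose j := Ordinal bn; have jS : j \notin S by apply: bS.
have jE T : adds_right S i T = (T == j |: S).
  apply/existsP/eqP => [[k /andP[/eqP kb /eqP ->]]|->]; last first.
    by exists j; rewrite !eqxx.
  by congr (_ |: _); apply: val_inj.
rewrite (big_pred1 (j |: S)) => [|T]; last exact: jE.
rewrite /row_weight nl ?jE // -/a -/b exponentsU1 // /x.
by congr (_ * (eulerian_coef n (incr _ _))%:R) => /=; lia.
Qed.

Definition ffun_cons (X : finType) q (x : X) (f : {ffun 'I_q -> X}) :
    {ffun 'I_q.+1 -> X} :=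
  [ffun k => if unlift ord0 k is Some l then f l else x].

Lemma ffun_cons0 (X : finType) q (x : X) (f : {ffun 'I_q -> X}) :
  ffun_cons x f ord0 = x.
Proof. by rewrite ffunE unlift_none. Qed.

Lemma ffun_consS (X : finType) q (x : X) (f : {ffun 'I_q -> X}) k :
  ffun_cons x f (lift ord0 k) = f k.
Proof. by rewrite ffunE liftK. Qed.

Lemma big_ffun_cons (X : finType) q (P : pred {ffun 'I_q.+1 -> X})
    (F : {ffun 'I_q.+1 -> X} -> R) :
  \sum_(f | P f) F f =
  \sum_x \sum_(f : {ffun 'I_q -> X} | P (ffun_cons x f)) F (ffun_cons x f).
Proof.
rewrite pair_big_dep /=.
rewrite (reindex (fun p : X * {ffun 'I_q -> X} => ffun_cons p.1 p.2)) //=.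
exists (fun f => (f ord0, [ffun k => f (lift ord0 k)])) => [[x f] _|f _] /=.
  by rewrite ffun_cons0; congr pair; apply/ffunP => k; rewrite ffunE ffun_consS.
apply/ffunP => k; rewrite ffunE; case: unliftP => [l ->|-> //].
by rewrite ffunE.
Qed.

Lemma forall_ord_recl q (p : pred 'I_q.+1) :
  [forall k, p k] = p ord0 && [forall k, p (lift ord0 k)].
Proof.
apply/forallP/andP => [h|[h0 /forallP h] k]; last by case: (unliftP ord0 k) => [l|] ->.
by split=> //; apply/forallP.
Qed.

Definition adds_box S i T := adds_left S i T || adds_right S i T.

(** Induction on the remaining row numbers, for an arbitrary first row [S]. Each row adds one box,
    so by the cardinality condition all columns are shaded when [r] is empty; the exponents are then
    all ones, whence the factorial. *)
Lemma eulerian_coef_diagrams r S : {subset r <= S} -> (#|S| + size r = n)%N ->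
  (eulerian_coef n (exponents S r))%:R =
  n`!%:R * \sum_(P : {ffun 'I_(size r).+1 -> {set 'I_n}} |
    (P ord0 == S) && [forall k : 'I_(size r),
       adds_box (P (widen_ord (leqnSn _) k)) (tnth (in_tuple r) k)
                (P (lift ord0 k))])
    \prod_(k < size r)
      row_weight R (P (widen_ord (leqnSn _) k)) (tnth (in_tuple r) k)
                 (P (lift ord0 k)) :> R.
Proof.
elim: r S => [|i r IH] S rS cS.
  rewrite (big_pred1 [ffun=> S]) => [|P].
    rewrite big_ord0 mulr1 -eulerian_coef1; congr (eulerian_coef n _)%:R.
    have -> : S = [set: 'I_n].
      apply/eqP; rewrite eqEcard finset.subsetT cardsT card_ord.
      by move: cS => /=; lia.
    apply/funext => m; rewrite /exponents big_nil addn0.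
    case: m => [|m] /=; first by rewrite big1.
    rewrite ltnS; case: (ltnP m n) => [mn|mn].
      rewrite (bigD1 (Ordinal mn)) ?inE //= big1 ?eqxx // => j /andP[_ jm].
      by rewrite eqSS eq_sym (negbTE (_ : val j != m)) //.
    by rewrite big1 // => j _; have := ltn_ord j; case: eqP; lia.
  rewrite [X in _ && X](_ : _ = true) ?andbT; last by apply/forallP => -[].
  apply/eqP/eqP => [P0|->]; last by rewrite ffunE.
  by apply/ffunP => k; rewrite ffunE ord1.
have iS : i \in S by apply: rS; rewrite mem_head.
rewrite eulerian_coef_diagram_step // big_ffun_cons.
rewrite [in RHS](bigD1 S) //= [X in _ * (_ + X)]big1 ?addr0; last first.
  move=> T /negbTE TS; rewrite big_pred0 // => f.
  by rewrite ffun_cons0 TS.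
have wd (k : 'I_(size r)) :
    widen_ord (leqnSn (size r).+1) (lift ord0 k) = lift ord0 (widen_ord (leqnSn _) k).
  exact: val_inj.
have w0 : widen_ord (leqnSn (size r).+1) ord0 = ord0 by exact: val_inj.
have tn (k : 'I_(size r)) :
    tnth (in_tuple (i :: r)) (lift ord0 k) = tnth (in_tuple r) k.
  by rewrite !(tnth_nth i).
pose ok (f : {ffun 'I_(size r).+1 -> {set 'I_n}}) := [forall k : 'I_(size r),
  adds_box (f (widen_ord (leqnSn _) k)) (tnth (in_tuple r) k) (f (lift ord0 k))].
pose wt (f : {ffun 'I_(size r).+1 -> {set 'I_n}}) : R := \prod_(k < size r)
  row_weight R (f (widen_ord (leqnSn _) k)) (tnth (in_tuple r) k) (f (lift ord0 k)).
rewrite [in RHS](eq_bigl (fun f : {ffun _ -> _} => adds_box S i (f ord0) && ok f)); last first.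
  move=> f; rewrite ffun_cons0 eqxx /= forall_ord_recl /=; congr (_ && _).
    by rewrite w0 ffun_cons0 ffun_consS (tnth_nth i).
  by apply: eq_forallb => k; rewrite wd !ffun_consS tn.
rewrite [in RHS](eq_bigr (fun f : {ffun _ -> _} => row_weight R S i (f ord0) * wt f)); last first.
  move=> f _; rewrite big_ord_recl w0 ffun_cons0 ffun_consS (tnth_nth i) /=.
  by congr (_ * _); apply: eq_bigr => k _; rewrite wd !ffun_consS tn.
(* Diagrams are grouped by their second row [T], which is the first row of a diagram for [r]. *)
rewrite [in RHS](partition_big (fun f : {ffun _ -> _} => f ord0) (adds_box S i)) /=; last first.
  by move=> f /andP[].
rewrite big_distrr /=; apply: eq_bigr => T aT.
have [j jS TE] : exists2 j, j \notin S & T = j |: S.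
  have [_ _ aS] := string_minP iS; have [_ _ bS] := string_maxP iS.
  case/orP: aT => /existsP[j /andP[/eqP ja /eqP ->]]; exists j => //.
    exact: aS.
  exact: bS.
rewrite IH.
- rewrite mulrCA; congr (_ * _); rewrite big_distrr /=.
  rewrite [in RHS](eq_bigl (fun f : {ffun _ -> _} => (f ord0 == T) && ok f)); last first.
    by move=> f /=; case: (eqVneq (f ord0) T) => [->|]; rewrite ?andbF // /adds_box aT andbT.
  by apply: eq_bigr => f /andP[/eqP fT _]; rewrite -fT.
- by move=> k kr; rewrite TE !inE rS ?orbT // inE kr orbT.
- by move: cS; rewrite TE cardsU1 jS /=; lia.
Qed.

End Field.
End Diagrams.

(** A column [j] with [c j > 0] counts once in the first row and [c j - 1] times among the row
    numbers. *)
Lemma exponents_row_numbers n (c : {ffun 'I_n -> nat}) :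
  exponents [set j | 0 < c j] (row_numbers c) =
  fun m => \sum_(j < n) c j * (m == j.+1).
Proof.
apply/funext => m; rewrite /exponents /row_numbers big_flatten big_map /=.
rewrite big_enum /= big_mkcond -big_split /=; apply: eq_bigr => j _.
rewrite big_nseq iter_addn inE.
by case: (m == j.+1); case: (c j) => [|k] /=;
  rewrite ?muln0 ?muln1 ?mul0n ?mul1n ?addn0 ?add0n ?add1n.
Qed.

Lemma sum_left_right_diagrams (R : realType) n (c : {ffun 'I_n -> nat}) :
  \sum_(i < n) c i = n ->
  (n`!%:R * \sum_(P in left_right_diagrams c) weight R P =
   (eulerian_coef n (fun m => \sum_(j < n) c j * (m == j.+1)))%:R :> R)%R.
Proof.
move=> hc; rewrite -exponents_row_numbers eulerian_coef_diagrams.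
- by congr (_ * _)%R; apply: eq_bigl => P; rewrite inE.
- move=> j; rewrite /row_numbers => /flatten_mapP[k _].
  by rewrite mem_nseq => /andP[ck /eqP ->]; rewrite inE; lia.
- rewrite /row_numbers size_flatten /shape -map_comp sumnE big_map big_enum /=.
  rewrite -sum1_card big_mkcond -big_split -[RHS]hc; apply: eq_bigr => j _ /=.
  by rewrite size_nseq inE; case: (c j) => [|k] //=; rewrite add1n.
Qed.

(** * Slices of permutohedra *)

Local Open Scope ring_scope.

Section Geometry.
Variable R : realType.
Implicit Types (a : nat -> R) (n k : nat).

Lemma convex_setP (E : lmodType R) (A : set E) :
  convex_set (A : set (convex_lmodType E)) <->
  (forall (x y : E) (t : R), 0 <= t <= 1 -> A x -> A y -> A (t *: x + (1 - t) *: y)).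
Proof.
split=> [cA x y t /andP[t0 t1] Ax Ay|cA x y t].
  by have := cA x y (Itv01 t0 t1); rewrite !inE; apply.
by rewrite !inE => Ax Ay; apply: cA => //; rewrite ge0 le1.
Qed.

Definition nonincreasing_upto n a :=
  forall i j, (i <= j <= n)%N -> a j <= a i.

(** Parameters come from a sequence on [nat], so that slicing can drop an index without a change of
    type. *)
Definition perm_hull n a : set 'rV[R]_n.+1 :=
  permutohedron (fun i : 'I_n.+1 => a i).

Lemma perm_hull_sub n a (A : set 'rV[R]_n.+1) :
  (forall x y t, 0 <= t <= 1 -> A x -> A y -> A (t *: x + (1 - t) *: y)) ->
  (forall w : {perm 'I_n.+1}, A (\row_i a (w i))) ->
  forall t, perm_hull a t -> A t.
Proof.
move=> cA vA; apply: smallest_sub; first exact/convex_setP.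
by move=> _ [w _ <-].
Qed.

Lemma perm_hull_vertex n a (w : {perm 'I_n.+1}) : perm_hull a (\row_i a (w i)).
Proof. by apply: sub_gen_smallest; exists w. Qed.

Lemma perm_hull_convex n a (x y : 'rV[R]_n.+1) t : 0 <= t <= 1 ->
  perm_hull a x -> perm_hull a y -> perm_hull a (t *: x + (1 - t) *: y).
Proof.
move=> t01 ax ay A AP; have [/= /convex_setP cA _] := AP.
by apply: cA => //; [exact: ax|exact: ay].
Qed.

Definition prefix_sum a m := \sum_(i < m) a i.

(** Rado's conditions, that is, majorization. The size of [p] is a sum of booleans so that it splits
    at the first coordinate just as the sum of coordinates does. *)
Definition dominated n a (t : 'rV[R]_n) :=
  \sum_i t 0 i = prefix_sum a n /\
  forall p : pred 'I_n, \sum_(i | p i) t 0 i <= prefix_sum a (\sum_i p i)%N.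

Lemma sum_pred_le n (p : pred 'I_n) : (\sum_i p i <= n)%N.
Proof.
rewrite -[leqRHS]card_ord -sum1_card; apply: leq_sum => i _.
by case: (p i).
Qed.

(** The last index, if selected, contributes at most the value at the first index not yet used by
    the prefix. *)
Lemma sum_le_prefix n a (p : pred 'I_n) : nonincreasing_upto n.-1 a ->
  \sum_(i | p i) a i <= prefix_sum a (\sum_i p i)%N.
Proof.
elim: n p => [|n IH] p ha; first by rewrite /prefix_sum !big_ord0.
have h : \sum_(i < n | p (widen_ord (leqnSn n) i)) a i <=
    prefix_sum a (\sum_(i < n) p (widen_ord (leqnSn n) i))%N.
  by apply: (IH (fun i => p (widen_ord (leqnSn n) i))) => i j ij; apply: ha; lia.
rewrite big_mkcond big_ord_recr -big_mkcond [(\sum_i _)%N]big_ord_recr /=.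
case: ifP => _; last by rewrite addr0 addn0.
rewrite addn1 /prefix_sum big_ord_recr /=; apply: lerD => //.
by apply: ha; rewrite leqnn sum_pred_le.
Qed.

Lemma dominated_vertex n a (w : {perm 'I_n.+1}) : nonincreasing_upto n a ->
  dominated a (\row_i a (w i)).
Proof.
move=> ha; split=> [|p].
  rewrite /prefix_sum [RHS](reindex_inj (@perm_inj _ w)).
  by apply: eq_bigr => i _; rewrite mxE.
have -> : \sum_(i | p i) (\row_i a (w i)) 0 i =
    \sum_(i | p ((w^-1)%g i)) a i.
  rewrite [RHS](reindex_inj (@perm_inj _ w)); apply: eq_big => [i|i _].
    by rewrite permK.
  by rewrite mxE.
rewrite [(\sum_i p i)%N](reindex_inj (@perm_inj _ (w^-1)%g)).
exact: (@sum_le_prefix n.+1 a (fun i => p ((w^-1)%g i))).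
Qed.

Lemma dominated_convex n a (x y : 'rV[R]_n) t : 0 <= t <= 1 ->
  dominated a x -> dominated a y -> dominated a (t *: x + (1 - t) *: y).
Proof.
move=> t01 [xs xp] [ys yp].
have sumE (p : pred 'I_n) : \sum_(i | p i) (t *: x + (1 - t) *: y) 0 i =
    t * (\sum_(i | p i) x 0 i) + (1 - t) * \sum_(i | p i) y 0 i.
  by rewrite !mulr_sumr -big_split; apply: eq_bigr => i _; rewrite !mxE.
split=> [|p]; first by rewrite sumE xs ys; ring.
rewrite sumE; have := xp p; have := yp p; set s := prefix_sum _ _ => h1 h2.
have -> : s = t * s + (1 - t) * s by ring.
by apply: lerD; apply: ler_wpM2l => //; lra.
Qed.

Lemma perm_hull_dominated n a t : nonincreasing_upto n a ->
  @perm_hull n a t -> dominated a t.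
Proof.
move=> ha; apply: perm_hull_sub => [x y l|w]; first exact: dominated_convex.
exact: dominated_vertex.
Qed.

(* The slice of the permutohedron at first coordinate [x], where
   [a k.+1 <= x <= a k], is again a permutohedron, with these parameters. *)
Definition slice k x a : nat -> R := fun i =>
  if (i < k)%N then a i else if i == k then a k + a k.+1 - x else a i.+1.

Lemma prefix_sum_slice k x a j :
  prefix_sum (slice k x a) j =
  if (j <= k)%N then prefix_sum a j else prefix_sum a j.+1 - x.
Proof.
rewrite /prefix_sum; elim: j => [|j IH]; first by rewrite !big_ord0.
rewrite big_ord_recr /= IH /slice.
case: (ltngtP j k) => [jk|kj|->].
- by rewrite big_ord_recr.
- by rewrite [in RHS]big_ord_recr /=; ring.
- by rewrite !big_ord_recr /=; ring.
Qed.

Lemma nonincreasing_slice n k x a : (k <= n)%N -> a k.+1 <= x <= a k ->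
  nonincreasing_upto n.+1 a -> nonincreasing_upto n (slice k x a).
Proof.
move=> kn xk ha i j ijn; rewrite /slice.
have hi := ha i; have hj := ha j; have hk := ha k.
have h1 : (i <= k)%N -> a k <= a i by move=> ?; apply: hi; lia.
have h2 : (k <= j)%N -> a j.+1 <= a k.+1 by move=> ?; apply: ha; lia.
have h3 := ha k k.+1 _.
have h4 : a k.+1 <= a k by apply: ha; lia.
case: (ltngtP i k) => ik; case: (ltngtP j k) => jk; try lia; try by apply: ha; lia.
- by have := h1 (ltnW ik); lra.
- by have := h2 (ltnW jk); lra.
- by [].
Qed.

Definition row_cons n (x : R) (v : 'rV[R]_n) : 'rV[R]_n.+1 :=
  row_mx (x%:M : 'rV_1) v.

Lemma row_cons0 n (x : R) (v : 'rV[R]_n) :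
  (row_cons x v) 0 ord0 = x.
Proof.
rewrite mxE; case: splitP => // j _; by rewrite ord1 mxE eqxx.
Qed.

Lemma row_consS n (x : R) (v : 'rV[R]_n) j :
  (row_cons x v) 0 (lift ord0 j) = v 0 j.
Proof.
rewrite mxE; case: splitP => [l|l [jl]]; first by rewrite ord1.
by congr (v 0 _); apply: val_inj.
Qed.

Lemma sum_row_cons n (x : R) (v : 'rV[R]_n) (p : pred 'I_n.+1) :
  \sum_(i | p i) (row_cons x v) 0 i =
  (if p ord0 then x else 0) + \sum_(j | p (lift ord0 j)) v 0 j.
Proof.
rewrite big_mkcond big_ord_recl row_cons0 [in RHS]big_mkcond; congr (_ + _).
by apply: eq_bigr => j _; rewrite row_consS.
Qed.

(** A set of [s] remaining coordinates can be tested with or without the first one. For [s <= k] the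
    test without it is the sharper one, for [s > k] the test with it; this is the case split of
    [prefix_sum_slice]. *)
Lemma dominated_slice n k x a (v : 'rV[R]_n.+1) :
  nonincreasing_upto n.+1 a -> (k <= n)%N -> a k.+1 <= x <= a k ->
  dominated a (row_cons x v) <-> dominated (slice k x a) v.
Proof.
move=> ha kn xk; have kx := prefix_sum_slice k x a.
split=> -[hs hp].
- have hs' : \sum_i v 0 i = prefix_sum (slice k x a) n.+1.
    rewrite kx ifF; last by rewrite leqNgt ltnS kn.
    by rewrite -hs (sum_row_cons x v xpredT) /= addrAC subrr add0r.
  split=> // p; rewrite kx.
  pose p' b : pred 'I_n.+2 := fun i => if unlift ord0 i is Some j then p j else b.
  have e1 b : \sum_(j | p' b (lift ord0 j)) v 0 j = \sum_(j | p j) v 0 j.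
    by apply: eq_bigl => j; rewrite /p' liftK.
  have e2 b : (\sum_(j < n.+1) p' b (lift ord0 j))%N = (\sum_j p j)%N.
    by apply: eq_bigr => j _; rewrite /p' liftK.
  have h b := hp (p' b); case: (leqP _ k) => _.
    have := h false; rewrite sum_row_cons e1 [(\sum_i _)%N]big_ord_recl e2.
    by rewrite /p' unlift_none add0r add0n.
  have := h true; rewrite sum_row_cons e1 [(\sum_i _)%N]big_ord_recl e2.
  by rewrite /p' unlift_none add1n lerBrDl.
- split=> [|p].
    rewrite (sum_row_cons x v xpredT) hs kx ifF; last by rewrite leqNgt ltnS kn.
    by rewrite /= addrC subrK.
  rewrite sum_row_cons big_ord_recl.
  have := hp (fun j => p (lift ord0 j)); rewrite kx.
  have := sum_pred_le (fun j => p (lift ord0 j)).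
  set s := (\sum_i p (lift ord0 i))%N => sn.
  case: (p ord0) => /=; case: leqP => sk h.
  + rewrite add1n /prefix_sum big_ord_recr /= -/(prefix_sum a s).
    have : a k <= a s by apply: ha; lia.
    by lra.
  + by rewrite add1n; lra.
  + by rewrite add0r add0n.
  + move: h; rewrite add0r add0n {1}/prefix_sum big_ord_recr /= -/(prefix_sum a s).
    have : a s <= a k.+1 by apply: ha; lia.
    by lra.
Qed.

(** The upper bound tests the first coordinate alone; the lower bound tests all the others and
    subtracts from the total. *)
Lemma dominated_first n a (x : R) (v : 'rV[R]_n) :
  dominated a (row_cons x v) -> a n <= x <= a 0%N.
Proof.
move=> [hs hp]; apply/andP; split.
  have := hp (fun i => i != ord0); rewrite sum_row_cons eqxx add0r.
  rewrite big_ord_recl eqxx /= add0n.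
  rewrite (eq_bigl xpredT) // (eq_bigr (fun=> 1%N)) // sum1_card card_ord.
  move: hs; rewrite (sum_row_cons x v xpredT) /prefix_sum big_ord_recr /=.
  by lra.
have := hp (fun i => i == ord0); rewrite sum_row_cons eqxx.
rewrite [X in _ + X]big_pred0 // [(\sum_i _)%N]big_ord_recl eqxx.
by rewrite [X in (_ + X)%N]big1 // addr0 addn0 /prefix_sum big_ord1.
Qed.

Lemma nonincreasing_locate n a (x : R) : a n.+1 <= x <= a 0%N ->
  exists2 k, (k <= n)%N & a k.+1 <= x <= a k.
Proof.
elim: n => [|n IH] xn; first by exists 0%N.
have [ax|/ltW xa] := leP x (a n.+1).
  by exists n.+1 => //; move: xn; lra.
have [|k kn xk] := IH; first by move: xn; lra.
by exists k => //; apply: leqW.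
Qed.

(** By convexity only vertices of the slice matter. Each lies on the segment between two vertices of
    the permutohedron, with [a k] and [a k.+1] in first place and these two values exchanged. *)
Lemma perm_hull_slice_sub n k x a (v : 'rV[R]_n.+1) :
  (k <= n)%N -> a k.+1 <= x <= a k -> perm_hull (slice k x a) v ->
  @perm_hull n.+1 a (row_cons x v).
Proof.
move=> kn /andP[xk1 xk].
pose A : set 'rV[R]_n.+1 :=
  fun v => @perm_hull n.+1 a (row_cons x v).
apply: (@perm_hull_sub n (slice k x a) A) => [u w t t01 Au Aw|w].
  rewrite /A (_ : row_cons _ _ = t *: (row_cons x u) +
    (1 - t) *: (row_cons x w)); first exact: perm_hull_convex.
  apply/rowP => i; rewrite [RHS]mxE [X in _ = X + _]mxE [X in _ = _ + X]mxE.
  case: (unliftP ord0 i) => [j ->|->].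
    by rewrite !row_consS !mxE.
  by rewrite !row_cons0; ring.
have kn2 : (k < n.+2)%N by lia.
have k1n2 : (k.+1 < n.+2)%N by lia.
pose w1 := lift_perm ord0 (Ordinal kn2) w.
pose w2 := lift_perm ord0 (Ordinal k1n2) w.
(* If [a k = a k.+1] the segment is a point and [t = 0] is taken. *)
have [t t01 tx] : exists2 t, 0 <= t <= 1 & x = t * a k + (1 - t) * a k.+1.
  have [akk|akk] := eqVneq (a k) (a k.+1).
    by exists 0; [rewrite lexx ler01|move: xk; rewrite akk; lra].
  have d0 : 0 < a k - a k.+1.
    by rewrite lt_neqAle eq_sym subr_eq0 akk; lra.
  exists ((x - a k.+1) / (a k - a k.+1)); last by field; apply: lt0r_neq0.
  by rewrite divr_ge0 ?ler_pdivrMr ?mul1r //; lra.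
rewrite /A (_ : row_cons _ _ = t *: \row_(i < n.+2) a (w1 i) +
    (1 - t) *: \row_(i < n.+2) a (w2 i)).
  by apply: perm_hull_convex => //; exact: perm_hull_vertex.
apply/rowP => i; rewrite [RHS]mxE [X in _ = X + _]mxE [X in _ = _ + X]mxE.
rewrite [X in _ = _ * X + _]mxE [X in _ = _ + _ * X]mxE; case: (unliftP ord0 i) => [j ->|->]; last first.
  by rewrite row_cons0 /w1 /w2 !lift_perm_id.
rewrite row_consS mxE /w1 /w2 !lift_perm_lift /= /slice /bump.
case: (ltngtP (w j) k) => [_|_|->] /=; rewrite ?add0n ?add1n.
- by ring.
- by ring.
- by rewrite tx; ring.
Qed.

(** The harder half of Rado's theorem, by induction on the dimension: the first coordinate lies
    between two consecutive parameters, and the rest is dominated by the slice there. *)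
Lemma dominated_perm_hull n a t : nonincreasing_upto n a ->
  dominated a t -> @perm_hull n a t.
Proof.
elim: n a t => [|n IH] a t ha.
  move=> [ts _]; have <- : \row_i a ((1%g : {perm 'I_1}) i) = t.
    apply/rowP => i; rewrite mxE perm1 (ord1 i).
    by move: ts; rewrite /prefix_sum !big_ord1 => ->.
  exact: perm_hull_vertex.
have -> : t = row_cons (t 0 ord0) (\row_(j < n.+1) t 0 (lift ord0 j)).
  apply/rowP => i; case: (unliftP ord0 i) => [j ->|->].
    by rewrite row_consS mxE.
  by rewrite row_cons0.
move: (t 0 ord0) (\row_j _) => x v dxv.
have [k kn xk] := nonincreasing_locate (dominated_first dxv).
apply: (perm_hull_slice_sub kn xk); apply: IH.
  exact: nonincreasing_slice.
exact/(dominated_slice _ ha kn xk).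
Qed.

Lemma perm_hull_slice n k x a (v : 'rV[R]_n.+1) :
  nonincreasing_upto n.+1 a -> (k <= n)%N -> a k.+1 <= x <= a k ->
  @perm_hull n.+1 a (row_cons x v) <->
  perm_hull (slice k x a) v.
Proof.
move=> ha kn xk; split; last exact: perm_hull_slice_sub.
move=> /(perm_hull_dominated ha) /(dominated_slice _ ha kn xk).
by apply: dominated_perm_hull; exact: nonincreasing_slice.
Qed.

Local Open Scope classical_set_scope.

Lemma drop_last_cons n (t : 'rV[R]_n.+2) x (v : 'rV[R]_n) :
  drop_last t = row_cons x v -> t = row_cons x (\row_j t 0 (lift ord0 j)).
Proof.
move=> tv; apply/rowP => i; case: (unliftP ord0 i) => [j ->|->].
  by rewrite row_consS mxE.
have := congr1 (fun r : 'rV_n.+1 => r 0 ord0) tv; rewrite /= !row_cons0 mxE => <-.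
by congr (t 0 _); apply: val_inj.
Qed.

Definition base n a : set 'rV[R]_n := @drop_last R n @` perm_hull a.

(** Dropping the last coordinate commutes with fixing the first one. *)
Lemma base_slice n k x a :
  nonincreasing_upto n.+1 a -> (k <= n)%N -> a k.+1 <= x <= a k ->
  [set v : 'rV[R]_n | base a (row_cons x v)] =
  base (slice k x a).
Proof.
move=> ha kn xk; apply/seteqP; split=> v /= [t at_ tv].
  exists (\row_(j < n.+1) t 0 (lift ord0 j)).
    by apply/(perm_hull_slice _ ha kn xk); rewrite -(drop_last_cons tv).
  apply/rowP => j; have := congr1 (fun r : 'rV_n.+1 => r 0 (lift ord0 j)) tv.
  rewrite row_consS !mxE => <-.
  by congr (t 0 _); apply: val_inj.
exists (row_cons x t); first exact/(perm_hull_slice _ ha kn xk).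
apply/rowP => i; rewrite [LHS]mxE; case: (unliftP ord0 i) => [j ->|->].
  rewrite [RHS]row_consS -tv [RHS]mxE (_ : widen_ord _ _ = lift ord0 (widen_ord (leqnSn n) j)).
    by rewrite row_consS.
  exact: val_inj.
rewrite row_cons0 (_ : widen_ord _ _ = ord0); first by rewrite row_cons0.
exact: val_inj.
Qed.

Lemma base_slice0 n x a : nonincreasing_upto n.+1 a -> ~~ (a n.+1 <= x <= a 0%N) ->
  [set v : 'rV[R]_n | base a (row_cons x v)] = set0.
Proof.
move=> ha /negP xa; apply/seteqP; split=> // v [t at_ tv]; apply: xa.
have := perm_hull_dominated ha at_.
rewrite (drop_last_cons tv).
exact: dominated_first.
Qed.

End Geometry.

(** * Divided powers *)

Section DividedPowers.
Variable R : realType.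
Implicit Types (x y : R) (u : seq R) (A : seq nat -> R).

Definition dpow x m : R := x ^+ m / m`!%:R.

Lemma dpow0 x : dpow x 0 = 1.
Proof. by rewrite /dpow expr0 fact0 divr1. Qed.

Lemma dpow0S m : dpow 0 m.+1 = 0.
Proof. by rewrite /dpow expr0n mul0r. Qed.

Definition dpow' x m : R := if m is m'.+1 then dpow x m' else 0.

Lemma is_derive_dpow (g : R -> R) (m : nat) x (dg : R) :
  is_derive x 1 g dg -> is_derive x 1 (fun y => dpow (g y) m) (dpow' (g x) m * dg).
Proof.
move=> hg; rewrite (_ : (fun y => _) = (m`!%:R)^-1 *: (g ^+ m)); last first.
  apply/funext => y; rewrite /dpow.
  by rewrite [RHS](_ : _ = (m`!%:R)^-1 * (g ^+ m) y) // exprfctE mulrC.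
apply: is_derive_eq; case: m => [|m] /=.
  by rewrite mul0r scale0r scaler0 mul0r.
have m0 : m.+1%:R != 0 :> R by rewrite pnatr_eq0.
have f0 : m`!%:R != 0 :> R by rewrite pnatr_eq0 -lt0n fact_gt0.
rewrite /GRing.scale /= /dpow factS natrM; field.
by rewrite f0 nat1r.
Qed.

Lemma dpowD x y m :
  dpow (x + y) m = \sum_(i < m.+1) dpow x (m - i) * dpow y i.
Proof.
rewrite /dpow exprDn mulr_suml; apply: eq_bigr => i _.
have im : (i <= m)%N by rewrite -ltnS.
have f0 k : k`!%:R != 0 :> R by rewrite pnatr_eq0 -lt0n fact_gt0.
rewrite -(bin_fact im) !natrM -mulr_natr.
have : 'C(m, i)%:R != 0 :> R by rewrite pnatr_eq0 -lt0n bin_gt0.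
have := f0 i; have := f0 (m - i)%N => h1 h2 h3.
by field; rewrite h1 h2 h3.
Qed.

(* The polynomial in [u] whose coefficient at the divided power monomial of
   exponents [c] is [A c], cut off at exponents below [N]. *)
Fixpoint ev N u A : R :=
  if u is x :: u' then \sum_(m < N) dpow x m * ev N u' (fun c => A (nat_of_ord m :: c))
  else A [::].

Lemma eq_ev N u A A' : (forall c, size c = size u -> A c = A' c) ->
  ev N u A = ev N u A'.
Proof.
elim: u A A' => [|x u IH] A A' h /=; first exact: h.
by apply: eq_bigr => m _; congr (_ * _); apply: IH => c cu; apply: h; rewrite /= cu.
Qed.

Lemma ev_sum N u (I : finType) (A : I -> seq nat -> R) :
  ev N u (fun c => \sum_i A i c) = \sum_i ev N u (A i).
Proof.
elim: u A => [//|x u IH] A /=.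
rewrite exchange_big; apply: eq_bigr => m _ /=.
by rewrite IH mulr_sumr.
Qed.

Lemma ev0 N u : ev N u (fun=> 0) = 0.
Proof. by elim: u => //= x u ->; rewrite big1 // => m _; rewrite mulr0. Qed.

Lemma ev_cat N u1 u2 A :
  ev N (u1 ++ u2) A = ev N u1 (fun c1 => ev N u2 (fun c2 => A (c1 ++ c2))).
Proof. by elim: u1 A => //= x u1 IH A; apply: eq_bigr => m _; rewrite IH. Qed.

Lemma is_derive_ev N u (F : R -> seq nat -> R) (F' : seq nat -> R) x :
  (forall c, size c = size u -> is_derive x 1 (F^~ c) (F' c)) ->
  is_derive x 1 (fun y => ev N u (F y)) (ev N u F').
Proof.
elim: u F F' => [|v u IH] F F' h /=; first exact: h.
rewrite (_ : (fun y => _) = \sum_(m < N)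
    (fun y => dpow v m *: ev N u (fun c => F y (nat_of_ord m :: c)))); last first.
  by apply/funext => y; rewrite fct_sumE.
apply: is_derive_sum => m; apply: is_deriveZ.
by apply: IH => c cu; apply: h; rewrite /= cu.
Qed.

Lemma sum_dpow' N x (h : nat -> R) : h N = 0 ->
  \sum_(m < N) dpow' x m * h m = \sum_(m < N) dpow x m * h m.+1.
Proof.
case: N => [|N] hN; first by rewrite !big_ord0.
by rewrite big_ord_recl big_ord_recr /= mul0r add0r hN mulr0 addr0.
Qed.

(** The binomial theorem for divided powers, after grouping the double sum by [q + m]; terms with
    [q + m >= N] vanish by the condition on [h]. *)
Lemma sum_dpow_merge N x y (h : nat -> R) : (forall m, (N <= m)%N -> h m = 0) ->
  \sum_(m < N) dpow y m * (\sum_(q < N) dpow x q * h (q + m)%N) =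
  \sum_(m < N) dpow (x + y) m * h m.
Proof.
move=> h0.
have -> : \sum_(m < N) dpow (x + y) m * h m =
  \sum_(m < N) \sum_(i < N | (i <= m)%N) dpow x (m - i) * dpow y i * h m.
  apply: eq_bigr => m _; rewrite dpowD mulr_suml.
  rewrite (big_ord_widen N (fun i => dpow x (m - i) * dpow y i * h m)) //.
rewrite (exchange_big_dep xpredT) //=; apply: eq_bigr => i _.
rewrite mulr_sumr.
have -> : \sum_(m < N | (i <= m)%N) dpow x (m - i) * dpow y i * h m =
    \sum_(0 + i <= m < N) dpow x (m - i) * dpow y i * h m.
  by rewrite add0n big_geq_mkord.
rewrite big_addn big_mkord.
rewrite (bigID (fun q : 'I_N => (q < N - i)%N)) /= [X in _ + X]big1 ?addr0; last first.
  by move=> q qi; rewrite h0 ?mulr0 //; lia.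
rewrite (big_ord_widen N (fun q => dpow x (q + i - i) * dpow y i * h (q + i)%N)).
  by apply: eq_bigr => q _; rewrite addnK; ring.
exact: leq_subr.
Qed.

End DividedPowers.

(** * Integration of the slices *)

Section Primitive.
Variable R : realType.
Implicit Types (x y : R) (u : seq R) (A : seq nat -> R).

Lemma evN N u A : ev N u (fun c => - A c) = - ev N u A.
Proof.
elim: u A => //= x u IH A; rewrite -sumrN; apply: eq_bigr => m _.
by rewrite IH mulrN.
Qed.

Lemma evD N u A A' : ev N u (fun c => A c + A' c) = ev N u A + ev N u A'.
Proof.
elim: u A A' => //= x u IH A A'; rewrite -big_split; apply: eq_bigr => m _ /=.
by rewrite IH mulrDr.
Qed.

(** Differentiation lowers the divided power of [alpha + y] or, with a sign, that of [beta - y].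
    After index shifts the sums over [j] telescope, and [sum_dpow_merge] fuses the last two
    variables. *)
Lemma is_derive_dpow_sum N (f : nat -> nat -> R) alpha beta q0 x :
  (forall p q, (N <= (p + q).+1)%N -> f p q = 0) ->
  is_derive x 1
    (fun y => \sum_(p < N) dpow (alpha + y) p * (\sum_(m < N) dpow (beta - y) m *
      (\sum_(q < N) dpow q0 q * (\sum_(j < m) f (p + j)%N (q + (m - j.+1))%N))))
    (- (\sum_(p < N) dpow (alpha + x) p *
       (\sum_(q < N) dpow (q0 + (beta - x)) q * f p q))).
Proof.
move=> f0.
pose G (p m : nat) :=
  \sum_(q < N) dpow q0 q * (\sum_(j < m) f (p + j)%N (q + (m - j.+1))%N).
rewrite (_ : (fun y => _) = \sum_(p < N) \sum_(m < N)
   (G p m *: ((fun y => dpow (alpha + y) p) * (fun y => dpow (beta - y) m)))); last first.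
  apply/funext => y; rewrite fct_sumE; apply: eq_bigr => p _.
  rewrite fct_sumE mulr_sumr; apply: eq_bigr => m _.
  by rewrite -/(G p m) mulrA mulrC.
have da : is_derive x 1 (fun y => alpha + y) 1.
  by have := is_deriveD (is_derive_cst alpha x 1) (is_derive_id x 1); rewrite add0r.
have db : is_derive x 1 (fun y => beta - y) (- 1).
  by have := is_deriveB (is_derive_cst beta x 1) (is_derive_id x 1); rewrite sub0r.
have D p m : is_derive x 1
   (G p m *: ((fun y => dpow (alpha + y) p) * (fun y => dpow (beta - y) m)))
   (G p m * (dpow (beta - x) m * dpow' (alpha + x) p -
             dpow (alpha + x) p * dpow' (beta - x) m)).
  have h1 := is_derive_dpow p da; have h2 := is_derive_dpow m db.
  apply: is_derive_eq; rewrite /GRing.scale /=; ring.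
have DS := @is_derive_sum _ _ _ N _ x 1 _ (fun p => @is_derive_sum _ _ _ N _ x 1 _
  (fun m => D p m)).
apply: (is_derive_eq DS).
set y := alpha + x; set z := beta - x.
have GN m : G N m = 0.
  rewrite /G big1 // => q _; rewrite big1 ?mulr0 // => j _.
  by rewrite f0 //; lia.
have GpN p : G p N = 0.
  rewrite /G big1 // => q _; rewrite big1 ?mulr0 // => j _.
  by rewrite f0 //; have := ltn_ord j; lia.
(* Only the summand [j = 0] of [G p m.+1] survives. *)
have Gdiff p m : G p m.+1 - G p.+1 m = \sum_(q < N) dpow q0 q * f p (q + m)%N.
  rewrite /G -sumrB; apply: eq_bigr => q _; rewrite -mulrBr; congr (_ * _).
  rewrite big_ord_recl addn0 subn1 /= -[RHS]addr0 -addrA; congr (_ + _).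
  by apply/eqP; rewrite subr_eq0; apply/eqP/eq_bigr => j _; congr f; rewrite /bump /=; lia.
have -> : \sum_(p < N) \sum_(m < N)
    (G p m * (dpow z m * dpow' y p - dpow y p * dpow' z m)) =
  \sum_(m < N) dpow z m * (\sum_(p < N) dpow' y p * G p m) -
  \sum_(p < N) dpow y p * (\sum_(m < N) dpow' z m * G p m).
  rewrite [X in _ = X - _](_ : _ =
      \sum_(p < N) \sum_(m < N) dpow z m * (dpow' y p * G p m)); last first.
    by rewrite exchange_big; apply: eq_bigr => m _; rewrite mulr_sumr.
  rewrite -sumrB; apply: eq_bigr => p _; rewrite mulr_sumr -sumrB.
  by apply: eq_bigr => m _; ring.
under eq_bigr => m _ do rewrite (@sum_dpow' _ _ _ (fun p => G p m)) //.
under [X in _ - X]eq_bigr => p _ do rewrite (@sum_dpow' _ _ _ (G p)) //.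
rewrite [X in X - _](_ : _ =
    \sum_(p < N) \sum_(m < N) dpow z m * (dpow y p * G p.+1 m)); last first.
  by rewrite exchange_big; apply: eq_bigr => m _; rewrite mulr_sumr.
rewrite -sumrB -sumrN; apply: eq_bigr => p _.
rewrite -(@sum_dpow_merge _ N q0 z (f p)); last by move=> m mN; apply: f0; lia.
rewrite mulr_sumr -sumrB mulr_sumr -sumrN; apply: eq_bigr => m _.
by rewrite -Gdiff; ring.
Qed.

(** The list starts at the virtual position 0; beyond its end the exponent is 0. *)
Definition coef_seq n (c : seq nat) : R := (eulerian_coef n (nth 0%N c))%:R.
Definition part_seq n k (c : seq nat) : R := (eulerian_part n k (nth 0%N c))%:R.

Lemma coef_seq_sum n c : (size c <= n.+2)%N -> sumn c != n -> coef_seq n c = 0.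
Proof.
move=> cn sc; rewrite /coef_seq eulerian_coef_sum //; apply: contraNN sc => /eqP sc.
rewrite sumnE (big_nth 0%N) big_mkord (big_ord_widen n.+2 (nth 0%N c)) //.
rewrite -[X in _ == X]sc big_mkcond; apply/eqP/eq_bigr => i _.
by case: ltnP => // ci; rewrite nth_default.
Qed.

Lemma part_seq_cat n k c1 p m q c2 : size c1 = k ->
  part_seq n k (c1 ++ [:: p, m, q & c2]) =
  \sum_(j < m) coef_seq n (c1 ++ [:: (p + j)%N, (q + (m - j.+1))%N & c2]).
Proof.
move=> ck; rewrite /part_seq /eulerian_part natr_sum.
have -> : nth 0%N (c1 ++ [:: p, m, q & c2]) k.+1 = m.
  by rewrite nth_cat ck ltnNge leqnSn /= subSn // subnn.
apply: eq_bigr => j _; congr (eulerian_coef n _)%:R; apply/funext => i.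
rewrite /contract !nth_cat ck.
have -> : (k.+1 < k)%N = false by lia.
have -> : (k.+2 < k)%N = false by lia.
have -> : (k.+1 - k = 1)%N by lia.
have -> : (k.+2 - k = 2)%N by lia.
rewrite ltnn subnn /=.
case: (ltngtP i k) => [//|ki|->]; last by rewrite subnn.
case: (eqVneq i k.+1) => [->|ik] /=; first by rewrite subSn // subnn.
have -> : (i.+1 < k)%N = false by lia.
have [d ->] : exists d, (i = k + d.+2)%N by exists (i - k).-2; lia.
by rewrite -addnS !addKn.
Qed.

(** Up to sign, a primitive of the volume of the slices as a function of the cut: only the
    differences next to the cut vary, and [u1], [u2] stay constant. *)
Lemma is_derive_part n k N u1 u2 alpha beta q0 x :
  size u1 = k -> size u2 = (n - k)%N -> (k <= n)%N -> (n.+1 < N)%N ->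
  is_derive x 1
    (fun y => ev N (u1 ++ [:: alpha + y, beta - y, q0 & u2]) (part_seq n k))
    (- ev N (u1 ++ [:: alpha + x, q0 + (beta - x) & u2]) (coef_seq n)).
Proof.
move=> u1k u2k kn nN; rewrite ev_cat -evN.
under eq_fun do rewrite ev_cat.
apply: is_derive_ev => c1 c1k /=.
pose f p q := ev N u2 (fun c2 => coef_seq n (c1 ++ [:: p, q & c2])).
have := @is_derive_dpow_sum N f alpha beta q0 x.
rewrite (_ : (fun y => _) = (fun y => \sum_(p < N) dpow (alpha + y) p *
    (\sum_(m < N) dpow (beta - y) m * (\sum_(q < N) dpow q0 q *
      ev N u2 (fun c2 => part_seq n k (c1 ++ [:: p : nat, m : nat, q : nat & c2]))))));
  last first.
  apply/funext => y; apply: eq_bigr => p _; congr (_ * _).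
  apply: eq_bigr => m _; congr (_ * _); apply: eq_bigr => q _; congr (_ * _).
  rewrite -ev_sum; apply: eq_ev => c2 _.
  by rewrite part_seq_cat // c1k.
apply => p q pq; rewrite /f -[RHS](ev0 N u2); apply: eq_ev => c2 c2k.
apply: coef_seq_sum; first by rewrite size_cat /= c1k c2k u1k u2k; lia.
by rewrite sumn_cat /=; lia.
Qed.

Lemma continuous_ev N (us : seq (R -> R)) A :
  (forall g, List.In g us -> continuous g) ->
  continuous (fun y => ev N [seq g y | g <- us] A).
Proof.
elim: us A => [|g us IH] A h /=; first by move=> y; exact: cst_continuous.
have -> : (fun y => \sum_(m < N) dpow (g y) m *
      ev N [seq g' y | g' <- us] (fun c => A (nat_of_ord m :: c))) =
  \sum_(m < N) (fun y => dpow (g y) m *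
      ev N [seq g' y | g' <- us] (fun c => A (nat_of_ord m :: c))).
  by apply/funext => y; rewrite fct_sumE.
elim/big_ind : _ => [y|f1 f2 c1 c2 y|m _ y].
- exact: cst_continuous.
- by apply: cvgD; [exact: c1|exact: c2].
- apply: cvgM; last by apply: IH => g' g'us; apply: h; right.
  apply: cvgM; last exact: cvg_cst.
  apply: (@continuous_comp _ _ _ g (fun z => z ^+ m)); first by apply: h; left.
  exact: exprn_continuous.
Qed.

End Primitive.

(** * Integrals of functions given piecewise on adjacent intervals *)

Section Integral.
Variable R : realType.
Implicit Types (b : nat -> R).
Local Open Scope classical_set_scope.

Lemma integral_derive (f F : R -> R) (x y : R) : x <= y -> continuous f ->
  (forall z : R, is_derive z 1 F (f z)) ->
  (\int[lebesgue_measure]_(z in `[x, y]) (f z)%:E = (F y - F x)%:E)%E.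
Proof.
rewrite le_eqVlt => /predU1P[->|xy] cf dF.
  by rewrite set_itv1 integral_set1 subrr.
have Fc : continuous F.
  by move=> z; apply/differentiable_continuous/derivable1_diffP.
rewrite EFinB; apply: continuous_FTC2 => //.
- exact: continuous_subspaceT.
- split; first by move=> z _.
    by apply: cvg_at_right_filter; exact: Fc.
  by apply: cvg_at_left_filter; exact: Fc.
- by move=> z _; rewrite derive1E; exact: derive_val.
Qed.

(** Measurability is proved along with the value because additivity over adjacent intervals uses it
    in the induction. *)
Lemma integral_pieces n b (G : measurableTypeR R -> \bar R) (f F : nat -> R -> R) :
  nonincreasing_upto n b ->
  (forall k z, (k < n)%N -> b k.+1 <= z <= b k -> G z = (f k z)%:E) ->
  (forall k, (k < n)%N -> continuous (f k)) ->
  (forall k (z : R), (k < n)%N -> is_derive z 1 (F k) (f k z)) ->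
  measurable_fun `[b n, b 0%N] G /\
  (\int[lebesgue_measure]_(z in `[b n, b 0%N]) G z =
   (\sum_(k < n) (F k (b k) - F k (b k.+1)))%:E)%E.
Proof.
elim: n => [|n IH] hb hG cf dF.
  by rewrite set_itv1 integral_set1 big_ord0; split=> //; exact: measurable_fun_set1.
have [||||mG iG] := IH.
- by move=> i j ij; apply: hb; lia.
- by move=> k z kn; apply: hG; lia.
- by move=> k kn; apply: cf; lia.
- by move=> k z kn; apply: dF; lia.
have bn : b n.+1 <= b n by apply: hb; lia.
have b0 : b n <= b 0%N by apply: hb; lia.
have mf : measurable_fun `[b n.+1, b n] G.
  apply: (@eq_measurable_fun _ _ _ _ _ (EFin \o f n)).
    by move=> z; rewrite inE /= in_itv /= => /hG -> //.
  apply/measurable_EFinP; apply: measurable_funTS.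
  exact: continuous_measurable_fun (cf n _).
have mf' : measurable_fun `[b n.+1, b n[ G.
  by apply: measurable_funS mf => //; apply: subset_itvl; rewrite bnd_simp.
(* A half-open piece makes the union disjoint; its missing endpoint does not change the integral. *)
have E : `[b n.+1, b 0%N] = `[b n.+1, b n[ `|` `[b n, b 0%N] :> set R.
  by rewrite -itv_bndbnd_setU // bnd_simp.
have mU : measurable_fun `[b n.+1, b 0%N] G.
  by rewrite E; apply/measurable_funU.
split=> //; rewrite E integral_setU //.
- rewrite iG integral_itv_bndo_bndc //.
  have -> : (\int[lebesgue_measure]_(z in `[b n.+1, b n]) G z =
      \int[lebesgue_measure]_(z in `[b n.+1, b n]) (f n z)%:E)%E.
    by apply: eq_integral => z; rewrite inE /= in_itv /= => /hG -> //.
  rewrite (integral_derive bn (cf n _) (fun z => dF n z _)) //.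
  by rewrite big_ord_recr /= -EFinD addrC.
- by rewrite -E.
- apply/disj_setPLR => z /=; rewrite !in_itv /= => /andP[_ zb].
  by rewrite leNgt zb.
Qed.

End Integral.

(** * The volume polynomial *)

Section Volume.
Variable R : realType.
Implicit Types (a : nat -> R).

Lemma volume_set0 n : volume (set0 : set 'rV[R]_n) = 0%:E.
Proof.
elim: n => [|n IH] /=; first by rewrite indic0.
rewrite (_ : (fun x => _) = cst 0%:E) ?integral_cst ?mul0e //.
by apply/funext => x; rewrite -IH.
Qed.

Definition diffs a i m : seq R := [seq a j - a j.+1 | j <- iota i m].

Lemma part_seq0 n k c : nth 0%N c k.+1 = 0%N -> part_seq R n k c = 0.
Proof. by move=> ck; rewrite /part_seq /eulerian_part ck big_ord0. Qed.

Lemma coef_seqS n c : coef_seq R n.+1 c = \sum_(k < n.+1) part_seq R n k c.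
Proof. by rewrite /coef_seq eulerian_coefS natr_sum. Qed.

Lemma diffs_split a n k : (k <= n)%N ->
  diffs a 0 n.+3 = diffs a 0 k ++
    [:: a k - a k.+1, a k.+1 - a k.+2, a k.+2 - a k.+3 & diffs a k.+3 (n - k)].
Proof.
move=> kn; rewrite /diffs (_ : n.+3 = k + (n - k).+3)%N; last by lia.
by rewrite iotaD map_cat add0n.
Qed.

Lemma diffs_slice a n k x : (k <= n)%N ->
  diffs (slice k.+1 x a) 0 n.+2 = diffs a 0 k ++
    [:: (a k - a k.+1 - a k.+2) + x, (a k.+2 - a k.+3) + (a k.+1 - x)
      & diffs a k.+3 (n - k)].
Proof.
move=> kn; rewrite /diffs (_ : n.+2 = k + (n - k).+2)%N; last by lia.
rewrite iotaD map_cat add0n /=; congr (_ ++ [:: _, _ & _]).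
- apply/eq_in_map => i; rewrite mem_iota => /andP[_ ik].
  by rewrite /slice !ifT //; lia.
- by rewrite /slice ltnSn ltnn eqxx; ring.
- rewrite /slice ltnn eqxx ltnNge leqnSn /= eqn_leq ltnn. by move=> /=; ring.
- rewrite -[k.+3]add1n iotaDl -map_comp; apply/eq_in_map => i.
  rewrite mem_iota => /andP[ki _] /=; rewrite add1n /slice.
  by do 4 (rewrite ifF; last by lia).
Qed.

(** The parameters are [a 1, ..., a n.+1]. The outer values [a 0] and [a n.+2] only enter the
    differences at the virtual positions; with them every slice has two neighbours. *)
Lemma volume_base n a N : nonincreasing_upto n (fun i => a i.+1) -> (n < N)%N ->
  volume (@base R n (fun i => a i.+1)) =
  (ev N (diffs a 0 n.+2) (coef_seq R n))%:E.
Proof.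
elim: n a => [|n IH] a ha nN.
  rewrite /= indicE mem_set; last first.
    exists (\row_i a ((1%g : {perm 'I_1}) i).+1).
      exact: (@perm_hull_vertex _ 0 (fun i => a i.+1)).
    by apply/rowP => -[].
  congr _%:E; case: N nN => // N _.
  rewrite big_ord_recl [X in _ + X]big1 => [|m _]; last first.
    by rewrite big1 ?mulr0 // => m' _; rewrite /coef_seq /= mulr0.
  rewrite big_ord_recl [X in _ * (_ + X) + _]big1 => [|m _]; last first.
    by rewrite /coef_seq /= mulr0.
  by rewrite !dpow0 /coef_seq /= !addr0 !mul1r.
set b : nat -> R := fun i => a i.+1.
pose alpha k := a k - a k.+1 - a k.+2.
pose f k x := ev N (diffs (slice k.+1 x a) 0 n.+2) (coef_seq R n).
(* A primitive of [f k]; at the lower end [x = a k.+2] the displayed entries are the differences of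
   [a] itself. *)
pose F k x := - ev N (diffs a 0 k ++
  [:: alpha k + x, a k.+1 - x, a k.+2 - a k.+3 & diffs a k.+3 (n - k)])
  (part_seq R n k).
have sliceE k x : (fun i => slice k.+1 x a i.+1) = slice k x b.
  by apply/funext => i; rewrite /slice ltnS eqSS.
have fE k x : (k <= n)%N -> f k x = ev N (diffs a 0 k ++
    [:: alpha k + x, (a k.+2 - a k.+3) + (a k.+1 - x) & diffs a k.+3 (n - k)])
    (coef_seq R n) by move=> kn; rewrite /f diffs_slice.
have szd i m : size (diffs a i m) = m by rewrite /diffs size_map size_iota.
pose G x := volume [set v : 'rV[R]_n | base b (row_cons x v)].
have hG k x : (k < n.+1)%N -> b k.+1 <= x <= b k -> G x = (f k x)%:E.
  rewrite ltnS => kn xk; rewrite /G (base_slice ha kn xk) -sliceE IH ?sliceE //.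
    exact: nonincreasing_slice.
  exact: ltnW.
have cf k : (k < n.+1)%N -> continuous (f k).
  rewrite ltnS => kn.
  rewrite (_ : f k = fun x => ev N [seq g x | g <- [seq cst y | y <- diffs a 0 k] ++
    [:: (fun x => alpha k + x), (fun x => (a k.+2 - a k.+3) + (a k.+1 - x))
    & [seq cst y | y <- diffs a k.+3 (n - k)]]] (coef_seq R n)).
    apply: continuous_ev => g; rewrite List.in_app_iff => -[|[<-|[<-|]]].
    - elim: (diffs a 0 k) => //= y u IHu [<-|//].
      by move=> z; exact: cst_continuous.
    - by move=> z; apply: cvgD; [exact: cvg_cst|exact: cvg_id].
    - move=> z; apply: cvgD; [exact: cvg_cst|apply: cvgB].
        exact: cvg_cst.
      exact: cvg_id.
    - elim: (diffs a _ _) => //= y u IHu [<-|//].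
      by move=> z; exact: cst_continuous.
  apply/funext => x; rewrite fE // map_cat /= -!map_comp.
  by congr (ev N (_ ++ [:: _, _ & _]) _); rewrite -[LHS]map_id; exact: eq_map.
have dF k (x : R) : (k < n.+1)%N -> is_derive x 1 (F k) (f k x).
  rewrite ltnS => kn; rewrite fE // -[X in is_derive _ _ _ X]opprK.
  by apply: is_deriveN; apply: is_derive_part.
have [_] := integral_pieces ha hG cf dF.
rewrite -[volume _]/(\int[lebesgue_measure]_x G x)%E.
have -> : (\int[lebesgue_measure]_x G x =
    \int[lebesgue_measure]_(x in `[b n.+1, b 0%N]) G x)%E.
  rewrite [RHS]integral_mkcond; apply: eq_integral => x _.
  rewrite /patch; case: ifPn => // xb; rewrite /G (base_slice0 ha) ?volume_set0 //.
  by apply: contraNN xb => xb; rewrite inE /= in_itv.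
move=> ->; congr _%:E.
have -> : coef_seq R n.+1 = fun c => \sum_(k < n.+1) part_seq R n k c.
  by apply/funext => c; rewrite coef_seqS.
rewrite ev_sum; apply: eq_bigr => k _; have kn : (k <= n)%N by rewrite -ltnS.
rewrite (diffs_split a kn) /F opprK /b.
(* At the upper end [x = a k.+1] the middle difference is 0, so only exponent 0 is left there, and
   for it [part_seq] vanishes. *)
rewrite [X in - X + _](_ : _ = 0) ?oppr0 ?add0r.
  by congr (ev N (_ ++ [:: _, _ & _]) _); rewrite /alpha; ring.
rewrite ev_cat -[RHS](ev0 N (diffs a 0 k)); apply: eq_ev => c1 c1k /=.
rewrite big1 // => p _; rewrite [X in _ * X]big1 ?mulr0 // => -[[|m] mN] _ /=.
  rewrite big1 ?mulr0 // => q _.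
  rewrite -[X in _ * X](_ : 0 = _) ?mulr0 // -[LHS](ev0 N (diffs a k.+3 (n - k))).
  apply: eq_ev => c2 _; rewrite part_seq0 // nth_cat c1k szd.
  by rewrite ltnNge leqnSn /= subSn // subnn.
by rewrite subrr dpow0S mul0r.
Qed.

End Volume.

(** * Recovering the coefficients from the values of the polynomial *)

Section Coefficients.
Variable R : realType.

Lemma ev_ffun N n (u : 'I_n -> R) (A : seq nat -> R) :
  ev N [seq u i | i <- enum 'I_n] A =
  \sum_(c : {ffun 'I_n -> 'I_N})
    A [seq nat_of_ord (c i) | i <- enum 'I_n] * \prod_(i < n) dpow (u i) (c i).
Proof.
elim: n u A => [|n IH] u A.
  have e0 : enum 'I_0 = [::] by apply: size0nil; rewrite size_enum_ord.
  rewrite e0 /= (big_pred1 (ffun0 (card_ord 0) : {ffun 'I_0 -> 'I_N})).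
    by rewrite big_ord0 mulr1.
  by move=> c /=; apply/esym/eqP/ffunP => -[].
rewrite big_ffun_cons enum_ordSl /= -map_comp; apply: eq_bigr => m _.
rewrite IH mulr_sumr; apply: eq_bigr => c _.
rewrite big_ord_recl ffun_cons0 mulrCA; congr (A (_ :: _) * (_ * _)).
  by rewrite -map_comp; apply: eq_map => i /=; rewrite ffun_consS.
by apply: eq_bigr => i _; rewrite ffun_consS.
Qed.

(** A polynomial of degree below [N] with the [N] roots [0, ..., N - 1] is zero. *)
Lemma poly_nonneg_eq0 N (h : nat -> R) :
  (forall x, 0 <= x -> \sum_(m < N) dpow x m * h m = 0) ->
  forall m, (m < N)%N -> h m = 0.
Proof.
move=> hx m mN.
pose p : {poly R} := \poly_(i < N) ((i`!%:R)^-1 * h i).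
have p0 : p = 0.
  apply/eqP/negPn/negP => pn0.
  have := max_poly_roots pn0 (rs := [seq i%:R | i <- iota 0 N]).
  rewrite size_map size_iota ltnNge size_poly => H; apply: notF; apply: H.
    apply/allP => _ /mapP[i _ ->]; rewrite rootE horner_poly; apply/eqP.
    rewrite -[RHS](hx i%:R) //; apply: eq_bigr => j _; rewrite /dpow; ring.
  by rewrite map_inj_uniq ?iota_uniq // => i j /eqP; rewrite eqr_nat => /eqP.
have : p`_m = 0 by rewrite p0 coef0.
rewrite coef_poly mN => /eqP; rewrite mulf_eq0 invr_eq0 pnatr_eq0.
by rewrite eqn0Ngt fact_gt0 /= => /eqP.
Qed.

(** One variable at a time. Only nonnegative arguments are available, as these are the differences
    of decreasing parameters. *)
Lemma ev_eq0 N n (A : seq nat -> R) :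
  (forall u : seq R, size u = n -> all (fun x => 0 <= x) u -> ev N u A = 0) ->
  forall c, size c = n -> all (fun m => m < N)%N c -> A c = 0.
Proof.
elim: n A => [|n IH] A h [|m c] //=.
  by move=> _ _; apply: (h [::]).
move=> [cn] /andP[mN cN]; apply: (IH (fun c => A (m :: c))) => // u un u0.
apply: (@poly_nonneg_eq0 N (fun m => ev N u (fun c => A (m :: c)))) => // x x0.
by apply: (h (x :: u)); rewrite /= ?un // x0.
Qed.

End Coefficients.

(** * Mixed Eulerian numbers *)

Section MixedEulerian.
Variable R : realType.

(** At both virtual positions only exponent 0 has a nonzero coefficient, so [x] and [y] drop out. *)
Lemma ev_coef_boundary n N x y (u : seq R) : (0 < N)%N -> size u = n ->
  ev N (x :: rcons u y) (coef_seq R n) =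
  ev N u (fun c => coef_seq R n (0%N :: c)).
Proof.
case: N => // N _ un; rewrite /= big_ord_recl [X in _ + X]big1 => [|m _]; last first.
  rewrite (@eq_ev _ _ _ _ (fun=> 0)) ?ev0 ?mulr0 // => c _.
  by rewrite /coef_seq eulerian_coef_left.
rewrite dpow0 mul1r addr0 -cats1 ev_cat; apply: eq_ev => c cu.
rewrite /= big_ord_recl [X in _ + X]big1 => [|m _]; last first.
  rewrite /coef_seq eulerian_coef_right ?mulr0 //= nth_cat cu un ltnn subnn.
  by rewrite /= /bump.
rewrite dpow0 mul1r addr0 /coef_seq; congr (eulerian_coef n _)%:R.
apply/funext => -[//|i] /=; rewrite nth_cat.
case: ltnP => // ci; rewrite [RHS]nth_default //.
by case: (i - size c)%N => [|[]].
Qed.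

(** The leading 0 is the exponent at position 0; the one at position [n.+1] is the default of
    [nth]. *)
Definition mixed_coef n (c : {ffun 'I_n -> nat}) : R :=
  coef_seq R n (0%N :: [seq c i | i <- enum 'I_n]).

Lemma mixed_coefE n (c : {ffun 'I_n -> nat}) :
  mixed_coef c = (eulerian_coef n (fun m => \sum_(j < n) c j * (m == j.+1)))%N%:R.
Proof.
rewrite /mixed_coef /coef_seq; congr (eulerian_coef n _)%:R; apply/funext => -[|m] /=.
  by rewrite big1 // => j _; rewrite muln0.
case: (ltnP m n) => mn.
  rewrite (nth_map (Ordinal mn)) ?size_enum_ord //.
  rewrite (nth_ord_enum (Ordinal mn) (Ordinal mn)) (bigD1 (Ordinal mn)) //= eqxx muln1.
  rewrite big1 ?addn0 // => j jm.
  by rewrite eqSS eq_sym (negbTE (_ : val j != m)) ?muln0.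
rewrite nth_default; last by rewrite size_map size_enum_ord.
rewrite big1 // => j _.
by rewrite eqSS gtn_eqF ?muln0 // (leq_trans (ltn_ord j)).
Qed.

Lemma sum_is_ev n (A : {ffun 'I_n -> nat} -> R) (u : 'I_n -> R) :
  \sum_(c : {ffun 'I_n -> 'I_n.+1} | (\sum_(i < n) c i == n)%N)
     A [ffun i => c i : nat] * \prod_(i < n) (u i ^+ c i / (c i)`!%:R) =
  ev n.+1 [seq u i | i <- enum 'I_n]
    (fun s => if sumn s == n then A [ffun i : 'I_n => nth 0%N s i] else 0).
Proof.
rewrite ev_ffun big_mkcond; apply: eq_bigr => c _.
have -> : sumn [seq nat_of_ord (c i) | i <- enum 'I_n] = (\sum_(i < n) c i)%N.
  by rewrite sumnE big_map big_enum.
case: ifP => _; last by rewrite mul0r.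
congr (A _ * _); apply/ffunP => i; rewrite !ffunE.
by rewrite (nth_map i) ?nth_ord_enum ?size_enum_ord.
Qed.

Lemma permutohedron_volumeE n (a : 'I_n.+1 -> R) :
  (forall i j : 'I_n.+1, (i <= j)%N -> a j <= a i) ->
  permutohedron_volume a =
  (ev n.+1 [seq a (widen_ord (leqnSn n) i) - a (lift ord0 i) | i <- enum 'I_n]
     (fun c => coef_seq R n (0%N :: c)))%:E.
Proof.
(* The shift by one makes room for position 0; [b 0] and [b n.+2] are fillers for the virtual
   positions. *)
move=> ha; pose b i := a (inord i.-1).
have ab : a = fun i : 'I_n.+1 => b i.+1.
  by apply/funext => i; rewrite /b /= inord_val.
have hb : nonincreasing_upto n (fun i => b i.+1).
  by move=> i j ijn; rewrite /b /=; apply: ha; rewrite !inordK; lia.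
rewrite /permutohedron_volume [X in volume (_ @` permutohedron X)%classic]ab.
rewrite -/(perm_hull _) -/(base _) (volume_base hb (ltnSn n)); congr _%:E.
have -> : diffs b 0 n.+2 = (b 0%N - b 1%N) :: rcons (diffs b 1 n) (b n.+1 - b n.+2).
  rewrite /diffs (_ : n.+2 = 1 + (n + 1))%N; last by lia.
  by rewrite !iotaD !map_cat -cats1 !addn1 add1n.
rewrite ev_coef_boundary //; last by rewrite size_map size_iota.
congr ev; rewrite /diffs -[1%N]addn0 iotaDl -val_enum_ord -!map_comp.
apply: eq_map => i /=; rewrite /b /= add1n /=.
congr (a _ - a _); apply: val_inj; rewrite /= inordK //; have := ltn_ord i; lia.
Qed.

Lemma is_mixed_eulerian_coef n : is_mixed_eulerian (@mixed_coef n).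
Proof.
move=> a ha; rewrite permutohedron_volumeE //; congr _%:E.
rewrite [RHS](sum_is_ev (@mixed_coef n)
  (fun i => a (widen_ord (leqnSn n) i) - a (lift ord0 i))).
apply: eq_ev => s; rewrite size_map size_enum_ord => sn.
have sE : [seq [ffun i : 'I_n => nth 0%N s i] i | i <- enum 'I_n] = s.
  rewrite -[RHS](mkseq_nth 0%N) sn /mkseq -val_enum_ord -map_comp.
  by apply: eq_map => i; rewrite ffunE.
rewrite /mixed_coef sE; case: ifPn => // ss.
by rewrite coef_seq_sum //= sn.
Qed.

Lemma is_mixed_eulerian_unique n (A B : {ffun 'I_n -> nat} -> R)
    (c : {ffun 'I_n -> nat}) :
  is_mixed_eulerian A -> is_mixed_eulerian B -> (\sum_(i < n) c i)%N = n ->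
  A c = B c.
Proof.
move=> hA hB hc.
pose ext (A : {ffun 'I_n -> nat} -> R) s : R :=
  if sumn s == n then A [ffun i : 'I_n => nth 0%N s i] else 0.
pose s := [seq c i | i <- enum 'I_n].
have ss : sumn s = n by rewrite sumnE big_map big_enum.
have extE (A' : {ffun 'I_n -> nat} -> R) : ext A' s = A' c.
  rewrite /ext ss eqxx; congr A'; apply/ffunP => i.
  by rewrite ffunE (nth_map i) ?nth_ord_enum ?size_enum_ord.
rewrite -!extE; apply/eqP; rewrite -subr_eq0; apply/eqP.
apply: (@ev_eq0 R n.+1 n (fun s => ext A s - ext B s)); last 2 first.
- by rewrite size_map size_enum_ord.
- apply/allP => _ /mapP[i _ ->]; rewrite ltnS -[X in (_ <= X)%N]hc.
  by rewrite (bigD1 i) //= leq_addr.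
move=> u un u0.
(* Tail sums realize any nonnegative [u] as the differences of decreasing parameters. *)
pose a (i : 'I_n.+1) : R := \sum_(i <= j < n) u`_j.
have ha (i j : 'I_n.+1) : (i <= j)%N -> a j <= a i.
  move=> ij; rewrite /a (@big_cat_nat _ _ _ j i n) //=; last by rewrite -ltnS.
  rewrite lerDr big_seq; apply: sumr_ge0 => k _.
  by case: (ltnP k (size u)) => ku; [exact: (all_nthP 0 u0)|rewrite nth_default].
have uE : [seq a (widen_ord (leqnSn n) i) - a (lift ord0 i) | i <- enum 'I_n] = u.
  rewrite -[RHS](mkseq_nth 0) un /mkseq -val_enum_ord -map_comp.
  apply: eq_map => i; rewrite /a /= /bump /= add1n big_ltn //.
  by rewrite addrK.
have := hA a ha; rewrite (hB a ha) => -[].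
rewrite (sum_is_ev A (fun i => a (widen_ord (leqnSn n) i) - a (lift ord0 i))).
rewrite (sum_is_ev B (fun i => a (widen_ord (leqnSn n) i) - a (lift ord0 i))).
rewrite uE => /eqP; rewrite eq_sym -subr_eq0 => /eqP AB.
rewrite -AB -evN -evD; exact: eq_ev.
Qed.

End MixedEulerian.

Theorem theorem5p9 (R : realType) (n : nat) (c : {ffun 'I_n -> nat})
    (hc : (\sum_(i < n) c i)%N = n) :
  mixed_eulerian R c =
  n`!%:R * \sum_(P in left_right_diagrams c) weight R P.
Proof.
rewrite sum_left_right_diagrams // -mixed_coefE.
apply: is_mixed_eulerian_unique hc; last exact: is_mixed_eulerian_coef.
(* The family chosen by [xget] is known only through its defining property; [mixed_coef] witnesses
   that the property can be met. *)
apply: (@xgetPex _ (fun=> 0)); exists (@mixed_coef R n).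
exact: is_mixed_eulerian_coef.
Qed.
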